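(* Let $(G,H,\sigma)$ be a reduced $1$-dimensional Hecke triple such that $$B=\{x\in G\mid\sigma(h)=\sigma(x^{-1}hx)\text{ for all }h\in H\cap xHx^{-1}\}$$ is a subgroup of $G$ and $(B,H)$ is directed. Denote by $H_\infty$ the subgroup $\bigcap_{x\in B^+}x^{-1}H_\sigma x$ of $H_\sigma$, and let $\mu_\infty$ be normalised Haar measure on $H_\infty$. Then the closed ideal generated by $p_\sigma$ in $C^*(B_\sigma)$ is equal to $C^*(B_\sigma)p_{\sigma,\infty}$, where $$p_{\sigma,\infty}=\int_{H_\infty}\sigma(h)h\,d\mu_\infty(h).$$
   Context: A Hecke pair $(G,H)$ is a group $G$ with a subgroup $H$ such that $[H:H\cap xHx^{-1}]<\infty$ for all $x\in G$. The Hecke topology from $(G,H)$ is the group topology on $G$ with $\{xHx^{-1}\mid x\in G\}$ as neighbourhood subbase at $e$; the pair is reduced if $\bigcap_{x\in G}xHx^{-1}=\{e\}$. The Schlichting completion of a reduced Hecke pair consists of the completion of $G$ in the Hecke topology (locally compact, totally disconnected) and the closure of the subgroup in it (compact open). A $1$-dimensional Hecke triple $(G,H,\sigma)$ is a Hecke pair $(G,H)$ with a unitary character $\sigma:H\to\mathbb{T}$ with finite range; $K=\ker\sigma$; it is reduced if the Hecke pair $(G,K)$ is. Its Schlichting completion $(G_\sigma,H_\sigma,\sigma)$: $(G_\sigma,K_\sigma)$ is the Schlichting completion of $(G,K)$, $H_\sigma$ is the closure of $H$ in $G_\sigma$ (compact open), and $\sigma$ denotes also the unique continuous extension to $H_\sigma$.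 $B_\sigma$ is the closure of $B$ in $G_\sigma$; when $B$ is a group it is an open subgroup of $G_\sigma$ containing $H_\sigma$. Haar measure is normalised so that $H_\sigma$ has measure $1$, and $p_\sigma=\chi_{H_\sigma}\sigma$ is a projection in $C_c(B_\sigma)\subset C^*(B_\sigma)$. $B^+=\{x\in B\mid xHx^{-1}\supset H\}$ (a semigroup; $\supset$ allows equality), and $(B,H)$ is called directed if $B=\{x^{-1}y\mid x,y\in B^+\}$. Group elements $h\in B_\sigma$ are identified with their images in the multiplier algebra $M(C^*(B_\sigma))$, in which the integral defining $p_{\sigma,\infty}$ is taken. *)

(* Defs.v *)
From HB Require Import structures.
From mathcomp Require Import all_boot all_order all_algebra.
From mathcomp Require Import finmap.
From mathcomp Require Import all_classical all_reals all_analysis.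
From mathcomp Require Import complex.

Set Implicit Arguments.
Unset Strict Implicit.
Unset Printing Implicit Defensive.

Import Order.TTheory GRing.Theory Num.Theory.
Import numFieldNormedType.Exports.

Local Open Scope classical_set_scope.
Local Open Scope ring_scope.

(* Declaring the type of [R[i]] as a [numClosedFieldType] is what makes the
   normed topology of [numFieldNormedType] available on it. *)
Definition Cplx (R : realType) : numClosedFieldType := R[i].

Section Groups.

Definition lcoset (G : groupType) (x : G) (A : set G) : set G :=
  [set (x * a)%g | a in A].

Definition rcoset (G : groupType) (A : set G) (x : G) : set G :=
  [set (a * x)%g | a in A].

(* [conjs x A] is x A x^-1, whereas [a ^ x] is x^-1 a x in MathComp. *)
Definition conjs (G : groupType) (x : G) (A : set G) : set G :=
  [set (x * a * x^-1)%g | a in A].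

Record subgroup (G : groupType) := Subgroup {
  subgroup_set : set G;
  subgroup1 : subgroup_set 1%g;
  subgroupM : forall x y,
    subgroup_set x -> subgroup_set y -> subgroup_set (x * y)%g;
  subgroupV : forall x, subgroup_set x -> subgroup_set x^-1%g }.

Definition subgroup_type (G : groupType) (S : subgroup G) : Type :=
  set_type (subgroup_set S).
(* The order of these two declarations matters: it makes a subgroup used as a
   type a [subgroup_type], which carries the group and topology instances. *)
Coercion subgroup_type : subgroup >-> Sortclass.
Coercion subgroup_set : subgroup >-> set.

Definition subgroup_val (G : groupType) (S : subgroup G) (x : S) : G := val x.

Section SubgroupType.
Variables (G : groupType) (S : subgroup G).
Implicit Types x y z : subgroup_type S.

Definition subgroup_sub (a : G) (Sa : subgroup_set S a) : subgroup_type S :=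
  SigSub (mem_set Sa).

Lemma subgroup_val_inj : injective (@subgroup_val G S).
Proof. exact: val_inj. Qed.

Lemma subgroup_valP x : subgroup_set S (subgroup_val x).
Proof. exact: set_mem (valP x). Qed.

Let one := subgroup_sub (subgroup1 S).
Let mul x y := subgroup_sub (subgroupM (subgroup_valP x) (subgroup_valP y)).
Let inv x := subgroup_sub (subgroupV (subgroup_valP x)).

Let mulA : associative mul.
Proof. by move=> x y z; apply: subgroup_val_inj; exact: mulgA. Qed.
Let mul1 : left_id one mul.
Proof. by move=> x; apply: subgroup_val_inj; exact: mul1g. Qed.
Let mulr1 : right_id one mul.
Proof. by move=> x; apply: subgroup_val_inj; exact: mulg1. Qed.
Let mulV : left_inverse one inv mul.
Proof. by move=> x; apply: subgroup_val_inj; exact: mulVg. Qed.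
Let mulrV : right_inverse one inv mul.
Proof. by move=> x; apply: subgroup_val_inj; exact: mulgV. Qed.

HB.instance Definition _ := Choice.on (subgroup_type S).
HB.instance Definition _ :=
  isGroup.Build (subgroup_type S) mulA mul1 mulr1 mulV mulrV.
HB.instance Definition _ := isPointed.Build (subgroup_type S) 1%g.

Lemma subgroup_val1 : subgroup_val (1%g : S) = 1%g. Proof. by []. Qed.

Lemma subgroup_valM :
  {morph @subgroup_val G S : x y / (x * y)%g >-> (x * y)%g}.
Proof. by []. Qed.

Lemma subgroup_valV : {morph @subgroup_val G S : x / x^-1%g >-> x^-1%g}.
Proof. by []. Qed.

End SubgroupType.

Program Definition image_subgroup (G L : groupType) (j : {multiplicative G -> L})
  (S : subgroup G) : subgroup L := @Subgroup L (j @` S) _ _ _.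
Next Obligation.
move=> G L j S; exists 1%g; first exact: subgroup1.
by apply: (mulgI (j 1%g)); rewrite -gmulfM !mulg1.
Qed.
Next Obligation.
move=> G L j S _ _ [x Sx <-] [y Sy <-].
by exists (x * y)%g; [exact: subgroupM | rewrite gmulfM].
Qed.
Next Obligation.
move=> G L j S _ [x Sx <-]; exists x^-1%g; first exact: subgroupV.
have j1 : j 1%g = 1%g by apply: (mulgI (j 1%g)); rewrite -gmulfM !mulg1.
by apply: (mulgI (j x)); rewrite -gmulfM !mulgV.
Qed.

Program Definition conj_subgroup (G : groupType) (x : G) (S : subgroup G) :
  subgroup G := @Subgroup G (conjs x S) _ _ _.
Next Obligation.
by move=> G x S; exists 1%g; [exact: subgroup1 | rewrite mulg1 mulgV].
Qed.
Next Obligation.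
move=> G x S _ _ [a Sa <-] [b Sb <-]; exists (a * b)%g; first exact: subgroupM.
by rewrite !mulgA mulgVK.
Qed.
Next Obligation.
move=> G x S _ [a Sa <-]; exists a^-1%g; first exact: subgroupV.
by rewrite !invgM invgK !mulgA.
Qed.

Program Definition bigcap_subgroup (I : Type) (G : groupType) (P : set I)
  (S : I -> subgroup G) : subgroup G :=
  @Subgroup G (\bigcap_(i in P) S i) _ _ _.
Next Obligation. by move=> I G P S i _; exact: subgroup1. Qed.
Next Obligation.
by move=> I G P S x y Sx Sy i Pi; apply: subgroupM; [exact: Sx | exact: Sy].
Qed.
Next Obligation. by move=> I G P S x Sx i Pi; apply: subgroupV; exact: Sx. Qed.

(* The subgroup [S] intersected with [T], as a subgroup of the group [T]. *)
Program Definition restrict_subgroup (G : groupType) (T S : subgroup G) :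
  subgroup (subgroup_type T) :=
  @Subgroup (subgroup_type T) (@subgroup_val G T @^-1` S) _ _ _.
Next Obligation. by move=> G T S; exact: subgroup1. Qed.
Next Obligation. by move=> G T S x y; exact: subgroupM. Qed.
Next Obligation. by move=> G T S x; exact: subgroupV. Qed.

End Groups.

HB.mixin Record isTopologicalGroup G of Group G & PointedTopological G := {
  mulg_continuous : continuous (fun xy : G * G => (xy.1 * xy.2)%g);
  invg_continuous : continuous (fun x : G => x^-1%g) }.

#[short(type="topologicalGroupType")]
HB.structure Definition TopologicalGroup :=
  {G of isTopologicalGroup G & Group G & PointedTopological G}.

HB.instance Definition _ (G : topologicalGroupType) (S : subgroup G) :=
  Topological.copy (subgroup_type S) (initial_topology (@subgroup_val G S)).

Section SubgroupTopology.
Variables (G : topologicalGroupType) (S : subgroup G).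

Lemma subgroup_val_continuous : continuous (@subgroup_val G S).
Proof. exact: initial_continuous. Qed.

Let continuous_into (T : topologicalType) (f : T -> S) :
  continuous (@subgroup_val G S \o f) -> continuous f.
Proof.
move=> cf; apply/continuousP => _ [U oU <-].
by move/continuousP: cf; exact.
Qed.

Fact subgroup_mul_continuous : continuous (fun xy : S * S => (xy.1 * xy.2)%g).
Proof.
apply: continuous_into => -[x y].
apply: (@continuous2_cvg _ _ _ _ (nbhs (x, y)) _ (@subgroup_val G S \o fst)
  (@subgroup_val G S \o snd) (fun a b => (a * b)%g)).
- exact: (@mulg_continuous G (subgroup_val x, subgroup_val y)).
- exact: (cvg_comp fst (@subgroup_val G S) (@cvg_fst _ _ (nbhs x) (nbhs y) _)
    (@subgroup_val_continuous x)).
- exact: (cvg_comp snd (@subgroup_val G S) (@cvg_snd _ _ (nbhs x) (nbhs y) _)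
    (@subgroup_val_continuous y)).
Qed.

Fact subgroup_inv_continuous : continuous (fun x : S => x^-1%g).
Proof.
apply: continuous_into => x; have H : ((fun z : G => z^-1%g) \o @subgroup_val G S) z @[z --> x] -->
    (subgroup_val x)^-1%g.
  exact: (cvg_comp (@subgroup_val G S) _ (@subgroup_val_continuous x)
    (@invg_continuous G (subgroup_val x))).
exact: H.
Qed.

HB.instance Definition _ := isTopologicalGroup.Build (subgroup_type S)
  subgroup_mul_continuous subgroup_inv_continuous.

End SubgroupTopology.

Program Definition closure_subgroup (G : topologicalGroupType) (S : subgroup G) :
  subgroup G := @Subgroup G (closure S) _ _ _.
Next Obligation.
by move=> G S; apply: subset_closure; exact: subgroup1.
Qed.
Next Obligation.
move=> G S x y Sx Sy U /(@mulg_continuous G (x, y)) [[V W] /= [Vx Wy] VWU].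
have [a [Sa Va]] := Sx V Vx; have [b [Sb Wb]] := Sy W Wy.
by exists (a * b)%g; split; [exact: subgroupM | exact: (VWU (a, b))].
Qed.
Next Obligation.
move=> G S x Sx U /(@invg_continuous G x) Ux.
have [a [Sa Ua]] := Sx _ Ux.
by exists a^-1%g; split; [exact: subgroupV | ].
Qed.

Section HeckePairs.
Variables (R : realType) (G : groupType).
Implicit Types (H K B : set G) (sigma : G -> Cplx R).

Definition finite_index (A A' : set G) : Prop :=
  finite_set [set lcoset a A' | a in A].

Definition hecke_pair H : Prop :=
  forall x : G, finite_index H (H `&` conjs x H).

Definition reduced_hecke_pair H : Prop :=
  hecke_pair H /\ \bigcap_(x in [set: G]) conjs x H = [set 1%g].

(* A character of a subgroup is a function on the whole group, of which only the
   values on the subgroup matter. *)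
Record unitary_character H sigma : Prop := UnitaryCharacter {
  characterM : forall h k, H h -> H k -> sigma (h * k)%g = sigma h * sigma k;
  character_norm : forall h, H h -> `|sigma h| = 1 }.

Definition character_kernel H sigma : set G := [set h | H h /\ sigma h = 1].

Record hecke_triple H sigma : Prop := HeckeTriple {
  hecke_triple_pair : hecke_pair H;
  hecke_triple_character : unitary_character H sigma;
  hecke_triple_finite : finite_set (sigma @` H) }.

Definition reduced_hecke_triple H sigma : Prop :=
  hecke_triple H sigma /\ reduced_hecke_pair (character_kernel H sigma).

Definition character_stabiliser H sigma : set G :=
  [set x | forall h, (H `&` conjs x H) h -> sigma h = sigma (x^-1 * h * x)%g].

Definition expanding B H : set G := [set x | B x /\ H `<=` conjs x H].

Definition directed_pair B H : Prop :=
  B = [set z | exists x y, [/\ expanding B H x, expanding B H y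
                             & z = (x^-1 * y)%g]].

(* Neighbourhoods of 1 in the group topology with subbase {x H x^-1} at 1. *)
Definition hecke_nbhs1 H : set_system G :=
  [set U | exists F : {fset G}, \bigcap_(x in [set` F]) conjs x H `<=` U].

End HeckePairs.

Section Completion.

(* Cauchy filters for the two-sided uniformity; completeness for it is the
   weakest (Raikov) one, and the one for which every Hausdorff topological group
   has a completion. *)
Definition group_cauchy (L : topologicalGroupType) (F : set_system L) : Prop :=
  forall U, nbhs (1%g : L) U -> exists2 D, F D &
    forall x y, D x -> D y -> U (x^-1 * y)%g /\ U (y * x^-1)%g.

Definition complete_group (L : topologicalGroupType) : Prop :=
  forall F : set_system L, ProperFilter F -> group_cauchy F ->
    exists x : L, F --> x.

(* [j] exhibits [L] as the Hausdorff completion of [G] in the Hecke topology of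
   (G,H).  As both topologies are group topologies, it is enough to compare the
   neighbourhoods of the unit; [j] is injective when (G,H) is reduced. *)
Record hecke_completion (G : groupType) (H : set G) (L : topologicalGroupType)
    (j : {multiplicative G -> L}) : Prop := HeckeCompletion {
  completion_hausdorff : hausdorff_space L;
  completion_complete : complete_group L;
  completion_dense : closure (range j) = [set: L];
  completion_nbhs1 : forall U : set G, hecke_nbhs1 H U <->
    exists2 V : set L, nbhs (1%g : L) V & j @^-1` V `<=` U }.

End Completion.

Definition borel (T : ptopologicalType) := g_sigma_algebraType (@open T).

Section HaarMeasure.
Variables (R : realType) (G : topologicalGroupType).
Implicit Type mu : {measure set (borel G) -> \bar R}.

Record left_haar_measure mu : Prop := LeftHaarMeasure {
  haar_invariant : forall (x : G) (E : set (borel G)),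
    measurable E -> mu (lcoset x E) = mu E;
  haar_compact : forall K : set G, compact K -> (mu K < +oo)%E;
  haar_outer : forall E : set (borel G), measurable E ->
    mu E = ereal_inf [set mu U | U in [set U : set G | open U /\ E `<=` U]];
  haar_inner : forall U : set G, open U ->
    mu U = ereal_sup [set mu K | K in [set K : set G | compact K /\ K `<=` U]];
  haar_neq0 : mu setT <> 0%E }.

Definition modular_function mu (Delta : G -> R) : Prop :=
  forall (x : G), 0 < Delta x /\
    forall E : set (borel G), measurable E ->
      mu (rcoset E x) = ((Delta x)%:E * mu E)%E.

Definition complex_integral mu (f : G -> Cplx R) : Cplx R :=
  Complex (Rintegral mu setT (fun x => complex.Re (f x)))
          (Rintegral mu setT (fun x => complex.Im (f x))).

Definition compactly_supported (f : G -> Cplx R) : Prop :=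
  continuous f /\
  exists2 K : set G, compact K & forall x, ~ K x -> f x = 0.

Definition convolution mu (f g : G -> Cplx R) (t : G) : Cplx R :=
  complex_integral mu (fun s => f s * g (s^-1 * t)%g).

(* [modular_function] is normalised by mu(E x) = Delta(x) mu(E), hence the factor
   Delta(t^-1). *)
Definition involution (Delta : G -> R) (f : G -> Cplx R) (t : G) : Cplx R :=
  real_complex R (Delta t^-1%g) * (f t^-1%g)^*.

End HaarMeasure.

HB.mixin Record CompleteNormedModule_isHilbert (R : realType) V
    of CompleteNormedModule (Cplx R) V := {
  ip : V -> V -> Cplx R;
  ip_linear : forall y, scalar (fun x => ip x y);
  ip_conj : forall x y, ip y x = (ip x y)^*;
  ip_norm : forall x, ip x x = `|x| ^+ 2 }.

#[short(type="hilbertType")]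
HB.structure Definition Hilbert (R : realType) :=
  {V of CompleteNormedModule_isHilbert R V & CompleteNormedModule (Cplx R) V}.

HB.mixin Record CompleteNormedModule_isCStarAlgebra (R : realType) A
    of CompleteNormedModule (Cplx R) A := {
  cmul : A -> A -> A;
  cstar : A -> A;
  cmulA : associative cmul;
  cmul_linearl : forall b, linear (fun a => cmul a b);
  cmul_linearr : forall a, linear (cmul a);
  cstarK : involutive cstar;
  cstarD : forall a b, cstar (a + b) = cstar a + cstar b;
  cstarZ : forall (c : Cplx R) a, cstar (c *: a) = c^* *: cstar a;
  cstarM : forall a b, cstar (cmul a b) = cmul (cstar b) (cstar a);
  cnormM : forall a b, `|cmul a b| <= `|a| * `|b|;
  cnorm_star : forall a, `|cmul (cstar a) a| = `|a| ^+ 2 }.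

(* C*-algebras need not be unital. *)
#[short(type="cstarAlgebraType")]
HB.structure Definition CStarAlgebra (R : realType) :=
  {A of CompleteNormedModule_isCStarAlgebra R A
      & CompleteNormedModule (Cplx R) A}.

Section CStarAlgebras.
Variables (R : realType) (A : cstarAlgebraType R).

(* Double centralizers: [lmul m a] is m a and [rmul m a] is a m. *)
Record multiplier := Multiplier {
  lmul : A -> A;
  rmul : A -> A;
  lmul_linear : linear lmul;
  rmul_linear : linear rmul;
  lmul_continuous : continuous lmul;
  rmul_continuous : continuous rmul;
  lmulM : forall a b, lmul (cmul a b) = cmul (lmul a) b;
  rmulM : forall a b, rmul (cmul a b) = cmul a (rmul b);
  multiplierM : forall a b, cmul (rmul a) b = cmul a (lmul b) }.

Record closed_ideal (I : set A) : Prop := ClosedIdeal {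
  ideal_closed : closed I;
  ideal0 : I 0;
  idealD : forall a b, I a -> I b -> I (a + b);
  idealZ : forall (c : Cplx R) a, I a -> I (c *: a);
  idealMl : forall a b, I b -> I (cmul a b);
  idealMr : forall a b, I a -> I (cmul a b) }.

Definition closed_ideal_generated (a : A) : set A :=
  smallest closed_ideal [set a].

End CStarAlgebras.

Section GroupCStarAlgebra.
Variables (R : realType) (G : topologicalGroupType).

Record unitary_representation (V : hilbertType R) (pi : G -> V -> V) : Prop :=
  UnitaryRepresentation {
  rep_linear : forall g, linear (pi g);
  rep1 : forall x, pi 1%g x = x;
  repM : forall g h x, pi (g * h)%g x = pi g (pi h x);
  rep_ip : forall g x y, ip (pi g x) (pi g y) = ip x y;
  rep_continuous : forall x, continuous (fun g => pi g x) }.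

(* The supremum of this set is the universal norm of [f], that is the supremum
   of the norms of the operators pi(f) = \int f(s) pi(s) ds. *)
Definition universal_norm_set (mu : {measure set (borel G) -> \bar R})
    (f : G -> Cplx R) : set (Cplx R) :=
  [set r | exists (V : hilbertType R) (pi : G -> V -> V) (x y : V),
    [/\ unitary_representation pi, `|x| <= 1, `|y| <= 1
      & r = `|complex_integral mu (fun s => f s * ip (pi s x) y)|]].

(* [iota] exhibits [A] as the completion C*(G) of the *-algebra C_c(G) in its
   universal norm; its values outside C_c(G) are irrelevant. *)
Record group_cstar_algebra (mu : {measure set (borel G) -> \bar R})
    (Delta : G -> R) (A : cstarAlgebraType R) (iota : (G -> Cplx R) -> A) : Prop :=
  GroupCStarAlgebra {
  iota_linear : forall (c : Cplx R) f g,
    compactly_supported f -> compactly_supported g ->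
    iota (fun t => c * f t + g t) = c *: iota f + iota g;
  iotaM : forall f g, compactly_supported f -> compactly_supported g ->
    iota (convolution mu f g) = cmul (iota f) (iota g);
  iota_star : forall f, compactly_supported f ->
    iota (involution Delta f) = cstar (iota f);
  iota_norm : forall f, compactly_supported f ->
    supremums (universal_norm_set mu f) `|iota f|;
  iota_dense : closure (iota @` [set f | compactly_supported f]) = [set: A] }.

(* The canonical map from G to M(C*(G)).  A multiplier is determined by its left
   action on the dense subspace [iota @` C_c(G)], hence so is [u]. *)
Definition canonical_multipliers (A : cstarAlgebraType R)
    (iota : (G -> Cplx R) -> A) (u : G -> multiplier A) : Prop :=
  forall (s : G) f, compactly_supported f ->
    lmul (u s) (iota f) = iota (fun t => f (s^-1 * t)%g).

(* [p] is the integral of the function f(h) u(h) in M(A) with its strict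
   topology: p a is, for each a in A, the integral of the A-valued function
   f(h) u(h) a, which is tested against the continuous linear functionals.
   These separate the points of A, and [lmul p] determines [rmul p], so that
   there is at most one such [p]. *)
Definition multiplier_integral (mu : {measure set (borel G) -> \bar R})
    (A : cstarAlgebraType R) (f : G -> Cplx R) (u : G -> multiplier A)
    (p : multiplier A) : Prop :=
  forall (a : A) (phi : A -> (Cplx R)^o), scalar phi -> continuous phi ->
    phi (lmul p a) = complex_integral mu (fun h => f h * phi (lmul (u h) a)).

End GroupCStarAlgebra.

Section SchlichtingData.
Variables (R : realType) (G : groupType) (L : topologicalGroupType).
Variables (j : {multiplicative G -> L}).

Definition completed_subgroup (S : subgroup G) : subgroup L :=
  closure_subgroup (image_subgroup j S).

(* [tau] is the continuous extension of the character [sigma] to H_sigma. *)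
Definition character_extension (H : subgroup G) (sigma : G -> Cplx R)
    (tau : L -> Cplx R) : Prop :=
  {within completed_subgroup H, continuous tau} /\
  forall h, subgroup_set H h -> tau (j h) = sigma h.

(* p_sigma = chi_{H_sigma} sigma, as a function on B_sigma. *)
Definition hecke_projection (B H : subgroup G) (tau : L -> Cplx R)
    (x : completed_subgroup B) : Cplx R :=
  if subgroup_val x \in subgroup_set (completed_subgroup H)
  then tau (subgroup_val x) else 0.

(* H_infty is first defined inside L; [H_infty_in] is the same group as a
   subgroup of B_sigma, in which it is contained. *)
Definition H_infty (B H : subgroup G) : subgroup L :=
  bigcap_subgroup (expanding B H)
    (fun x => conj_subgroup (j x)^-1%g (completed_subgroup H)).

Definition H_infty_in (B H : subgroup G) : subgroup (completed_subgroup B) :=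
  restrict_subgroup (completed_subgroup B) (H_infty B H).

End SchlichtingData.

(* Main.v *)
(* Write Q_x a = x^-1 p_sigma x a for x in B^+. This operator on C^*(B_sigma)
   averages sigma(k) k over k in x^-1 H_sigma x, a subgroup of H_sigma which
   shrinks as x grows in the directed set B^+. If a is the image of a function
   that is left invariant under a small open subgroup W, the average is a finite
   one, over coset representatives modulo W. By compactness x^-1 H_sigma x lies in
   H_infty W for large x, so Q_x a is eventually equal to the average over
   H_infty / (H_infty n W), which is p_infty a. Such elements a are dense and the
   Q_x are uniformly bounded, so Q_x converges pointwise to an operator P.
   Right translation by an element of B^+ is cofinal in B^+, hence P commutes with
   B^+, hence with B_sigma, hence P is a central multiplier. Finally Q_x a
   belongs to the ideal generated by p_sigma, and P p_sigma = p_sigma gives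
   P Q_x = Q_x, so that this ideal is the range of P. *)

Require Import Defs.
From HB Require Import structures.
From mathcomp Require Import all_boot all_order all_algebra.
From mathcomp Require Import finmap.
From mathcomp Require Import all_classical all_reals all_analysis.
From mathcomp Require Import complex.
From mathcomp Require Import measurable_realfun ring.

Set Implicit Arguments.
Unset Strict Implicit.
Unset Printing Implicit Defensive.

Import Order.TTheory GRing.Theory Num.Theory.
Import numFieldNormedType.Exports.

Local Open Scope classical_set_scope.
Local Open Scope ring_scope.

(** * Complex numbers *)

(** The subgroup H_infty need not be open in B_sigma, and then p_infty is not given by a function in
    C_c(B_sigma): it has to be built as an operator and compared with the integral afterwards. All
    analysis is brought down to finite sums. B_sigma has arbitrarily small open subgroups, functions
    invariant under one of them have norm-dense image in C^*(B_sigma), and their integrals and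
    convolutions are sums over coset representatives. The triple enters in two ways. The definition
    of B makes sigma invariant under conjugation by B^+, so that all the averages use the same
    character. The finite range of sigma gives K finite index in H, from which H_sigma is compact.
    Passing from translations to products rests on one further fact: if b comes from a function
    invariant under an open subgroup, so does P b. Multiplication by an invariant f is then the same
    finite sum of translations on b and on P b. *)

Section ComplexFacts.
Variable R : realType.
Implicit Types z w : Cplx R.

Let C (r : R) : Cplx R := real_complex R r.

Lemma ler_real_complex (r s : R) : (C r <= C s) = (r <= s).
Proof. exact: lecR. Qed.

Lemma ltr_real_complex (r s : R) : (C r < C s) = (r < s).
Proof. exact: ltcR. Qed.

Lemma norm_Re_le z : C `|complex.Re z| <= `|z|.
Proof. exact: normc_ge_Re. Qed.

Lemma norm_Im_le z : C `|complex.Im z| <= `|z|.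
Proof.
rewrite normc_def ler_real_complex -sqrtr_sqr ler_wsqrtr// lerDr.
exact: sqr_ge0.
Qed.

Lemma norm_le_Re_Im z : `|z| <= C (`|complex.Re z| + `|complex.Im z|).
Proof.
rewrite normc_def ler_real_complex.
set s := `|_| + _; have s0 : 0 <= s by rewrite addr_ge0.
rewrite -[leRHS](ger0_norm s0) -(sqrtr_sqr s) ler_wsqrtr// sqrrD.
by rewrite !real_normK ?num_real// lerD2r lerDl mulrn_wge0// mulr_ge0.
Qed.

Lemma pos_real_complex z : 0 < z -> exists2 r : R, 0 < r & z = C r.
Proof.
case: z => a b; rewrite ltcE /= => /andP[/eqP b0 a0].
by exists a => //; rewrite b0.
Qed.

Lemma ge0_real_complex z : 0 <= z -> exists2 r : R, 0 <= r & z = C r.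
Proof.
case: z => a b; rewrite lecE /= => /andP[/eqP b0 a0].
by exists a => //; rewrite b0.
Qed.

Lemma continuous_Re : continuous (fun z => complex.Re z).
Proof.
move=> z; apply/(@cvgrPdist_lt _ _ _ _ (nbhs_filter z)) => e e0.
have Ce0 : 0 < C e by rewrite (ltr_real_complex 0).
apply: filterS (nbhsx_ballx z _ Ce0) => w; rewrite -ball_normE /ball_ /=.
by rewrite -raddfB -ltr_real_complex; apply: le_lt_trans; exact: norm_Re_le.
Qed.

Lemma continuous_Im : continuous (fun z => complex.Im z).
Proof.
move=> z; apply/(@cvgrPdist_lt _ _ _ _ (nbhs_filter z)) => e e0.
have Ce0 : 0 < C e by rewrite (ltr_real_complex 0).
apply: filterS (nbhsx_ballx z _ Ce0) => w; rewrite -ball_normE /ball_ /=.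
by rewrite -raddfB -ltr_real_complex; apply: le_lt_trans; exact: norm_Im_le.
Qed.

End ComplexFacts.

(** * Integration on topological groups *)

(** Representatives, taken in C, of the left cosets x V that meet C. As C need not be a union of
    cosets, H_infty/(H_infty n W) is encoded by V = W and C = H_infty. *)
Definition coset_reps (G : groupType) (V : set G) (C : set G) (s : seq G) :=
  [/\ uniq s, forall x, x \in s -> C x,
      forall x y, x \in s -> y \in s -> V (x^-1 * y)%g -> x = y
    & forall c, C c -> exists2 x, x \in s & V (x^-1 * c)%g].

Section TopologicalGroups.
Variable G : topologicalGroupType.

Lemma continuous_mulgl (s : G) : continuous (fun t => s * t)%g.
Proof.
move=> t; apply: (@continuous2_cvg _ _ _ _ (nbhs t) _ (fun=> s) id
  (fun a b => (a * b)%g)); [exact: (mulg_continuous (s, t))|exact: cvg_cst|exact: cvg_id].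
Qed.

Lemma continuous_mulgr (s : G) : continuous (fun t => t * s)%g.
Proof.
move=> t; apply: (@continuous2_cvg _ _ _ _ (nbhs t) _ id (fun=> s)
  (fun a b => (a * b)%g)); [exact: (mulg_continuous (t, s))|exact: cvg_id|exact: cvg_cst].
Qed.

Lemma lcosetE (x : G) (V : set G) : lcoset x V = (fun t => x^-1 * t)%g @^-1` V.
Proof.
apply/seteqP; split=> [_ [t Vt <-] /=|t /= Vt]; first by rewrite mulKg.
by exists (x^-1 * t)%g => //; rewrite mulVKg.
Qed.

Lemma open_lcoset (x : G) (V : set G) : open V -> open (lcoset x V).
Proof. by rewrite lcosetE; move/continuousP: (@continuous_mulgl x^-1%g); exact. Qed.

End TopologicalGroups.

Section BorelIntegral.
Variables (R : realType) (G : topologicalGroupType).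
Implicit Type mu : {measure set (borel G) -> \bar R}.

Lemma borel_open (U : set G) : open U -> measurable (U : set (borel G)).
Proof. by move=> oU; apply: sub_sigma_algebra. Qed.

Lemma borel_continuous (f : G -> R) :
  continuous f -> measurable_fun setT (f : borel G -> R).
Proof.
move=> /continuousP cf; apply: (measurability _ (measurable_realfun.RGenOpens.measurableE R)).
move=> _ [_ [a [b ->] <-]]; rewrite setTI; apply: borel_open.
exact/cf/interval_open.
Qed.

Lemma borel_continuous_group (f : G -> G) :
  continuous f -> measurable_fun setT (f : borel G -> borel G).
Proof.
move=> /continuousP cf; apply: (@measurability _ _ (borel G) (borel G) setT f (@open G)) => //.
by move=> _ [U oU <-]; rewrite setTI; apply: borel_open; exact: cf.
Qed.

Lemma bounded_Rintegral mu (f : G -> R) (E : set (borel G)) (c : R) :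
  measurable_fun setT (f : borel G -> R) -> measurable E -> (mu E < +oo)%E ->
  (forall t, `|f t| <= c) -> (forall t, ~ E t -> f t = 0) ->
  mu.-integrable setT (EFin \o f) /\
  `|Rintegral mu setT f| <= c * fine (mu E).
Proof.
move=> mf mE Efin fc f0.
have fE : f \_ E = f.
  by apply/funext => t; rewrite patchE; case: ifPn => // /negP; rewrite inE => /f0 ->.
have intE : mu.-integrable E (EFin \o f).
  apply: measurable_bounded_integrable => //; first exact: measurable_funTS.
  exists c; split; first exact: num_real.
  by move=> x cx t _ /=; apply: le_trans (fc t) (ltW cx).
split.
  have -> : EFin \o f = (EFin \o f) \_ E.
    by rewrite -[in LHS]fE restrict_EFin.
  exact/(integrable_mkcond _ mE).
rewrite -fE -Rintegral_mkcond; apply: le_trans (le_normr_Rintegral mE intE) _.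
rewrite -Rintegral_cst//; apply: le_Rintegral => //.
- by have /integrable_norm := intE.
- apply: measurable_bounded_integrable => //.
  exists `|c|; split; first exact: num_real.
  by move=> x cx t _ /=; exact: ltW.
Qed.

Definition cintegrable mu (f : G -> Cplx R) :=
  mu.-integrable setT (EFin \o (fun t : borel G => complex.Re (f t))) /\
  mu.-integrable setT (EFin \o (fun t : borel G => complex.Im (f t))).

(** The factor 2 comes from estimating real and imaginary parts separately; later constants are
    chosen to absorb it. *)
Lemma complex_integral_bound mu (f : G -> Cplx R) (E : set (borel G)) (c : R) :
  continuous f -> measurable E -> (mu E < +oo)%E ->
  (forall t, `|f t| <= real_complex R c) -> (forall t, ~ E t -> f t = 0) ->
  cintegrable mu f /\
  `|complex_integral mu f| <= real_complex R (2 * c * fine (mu E)).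
Proof.
move=> cf mE Efin fc f0.
have cRe : continuous (fun t => complex.Re (f t)).
  by move=> t; apply: continuous_comp; [exact: cf|exact: continuous_Re].
have cIm : continuous (fun t => complex.Im (f t)).
  by move=> t; apply: continuous_comp; [exact: cf|exact: continuous_Im].
have [|t|iRe bRe] := bounded_Rintegral (borel_continuous cRe) mE Efin (c := c).
- by move=> t; rewrite -ler_real_complex; exact: le_trans (norm_Re_le _) (fc t).
- by move=> /f0 ->.
have [|t|iIm bIm] := bounded_Rintegral (borel_continuous cIm) mE Efin (c := c).
- by move=> t; rewrite -ler_real_complex; exact: le_trans (norm_Im_le _) (fc t).
- by move=> /f0 ->.
split=> //; apply: le_trans (norm_le_Re_Im _) _; rewrite ler_real_complex /=.
by rewrite -mulrA [leRHS]mulr_natl mulr2n lerD.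
Qed.

Lemma complex_integralB mu (f g : G -> Cplx R) :
  cintegrable mu f -> cintegrable mu g ->
  complex_integral mu (fun t => f t - g t) =
  complex_integral mu f - complex_integral mu g.
Proof.
move=> [fr fi] [gr gi]; rewrite /complex_integral.
under eq_Rintegral do rewrite raddfB.
rewrite RintegralB//.
under [X in Complex _ X]eq_Rintegral do rewrite raddfB.
by rewrite RintegralB.
Qed.

(** Left invariance says that the image of [mu] under t |-> s t is [mu], so this is a change of
    variables in the real and in the imaginary part. *)
Lemma complex_integral_translate mu (f : G -> Cplx R) (s : G) :
  left_haar_measure mu -> continuous f -> cintegrable mu (fun t => f (s * t)%g) ->
  complex_integral mu (fun t => f (s * t)%g) = complex_integral mu f.
Proof.
move=> mu_haar cf [ir ii].
have cs := @continuous_mulgl G s.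
have push (h : G -> R) : continuous h ->
    mu.-integrable setT (EFin \o (fun t : borel G => h (s * t)%g)) ->
    Rintegral mu setT (fun t => h (s * t)%g) = Rintegral mu setT h.
  move=> ch ih; rewrite /Rintegral; congr fine.
  have mh : measurable_fun setT (EFin \o (h : borel G -> R)).
    by apply/measurable_EFinP; exact: borel_continuous ch.
  have ms := borel_continuous_group cs.
  have := @integral_pushforward _ _ (borel G) (borel G) R _ ms mu setT _ mh ih
    (@measurableT _ _).
  rewrite preimage_setT => <-; apply: eq_measure_integral => E mE _.
  rewrite /pushforward -(haar_invariant mu_haar s^-1%g mE); congr (mu _).
  apply/seteqP; split=> [t /= Et|_ [t Et <-] /=].
    by exists (s * t)%g => //; rewrite mulKg.
  by rewrite mulVKg.
rewrite /complex_integral; congr Complex.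
  apply: (push (fun t => complex.Re (f t))) => // t.
  by apply: continuous_comp; [exact: cf|exact: continuous_Re].
apply: (push (fun t => complex.Im (f t))) => // t.
by apply: continuous_comp; [exact: cf|exact: continuous_Im].
Qed.

(** Such an f is a finite combination of indicators of cosets x V, which all have the measure of V.
    This is how integrals and convolutions become finite sums. *)
Lemma step_integral mu (V : subgroup G) (f : G -> Cplx R) (C : set G) (s : seq G) :
  left_haar_measure mu -> open (V : set G) -> (mu (subgroup_set V) < +oo)%E ->
  coset_reps V C s ->
  (forall t t', subgroup_set V (t^-1 * t')%g -> f t = f t') ->
  (forall t, f t != 0 -> C t) ->
  complex_integral mu f = \sum_(x <- s) f x * real_complex R (fine (mu (subgroup_set V))).
Proof.
move=> mu_haar oV Vfin [us sC sV sCV] fV fC.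
have mV : measurable (V : set (borel G)) by exact: borel_open.
have mxV (x : G) : measurable (lcoset x V : set (borel G)).
  exact: (borel_open (open_lcoset x oV)).
have step1 (x : G) (c : R) :
    mu.-integrable setT (EFin \o (fun t : borel G => c * \1_(lcoset x V) t)) /\
    Rintegral mu setT (fun t => c * \1_(lcoset x V) t) = c * fine (mu (subgroup_set V)).
  have muxV : mu (lcoset x V) = mu (subgroup_set V) by rewrite (haar_invariant mu_haar x mV).
  have mI : measurable_fun setT (fun t : borel G => \1_(lcoset x V) t : R).
    exact: measurable_indic.
  have [|t|t nt|iI _] := @bounded_Rintegral mu (\1_(lcoset x V)) (lcoset x V) 1 mI (mxV x).
  - by rewrite muxV.
  - by rewrite indicE; case: (_ \in _); rewrite ?normr1 ?normr0.
  - by rewrite indicE memNset.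
  split.
    have := integrableZl measurableT c iI.
    by apply: eq_integrable => // t _; rewrite /= EFinM.
  rewrite RintegralZl// /Rintegral integral_indic// setIT.
  by rewrite muxV.
have stepn (c : G -> R) :
    mu.-integrable setT (EFin \o (fun t : borel G => \sum_(x <- s) c x * \1_(lcoset x V) t)) /\
    Rintegral mu setT (fun t => \sum_(x <- s) c x * \1_(lcoset x V) t) =
      \sum_(x <- s) c x * fine (mu (subgroup_set V)).
  elim: (s) => [|x r [ir er]].
    rewrite big_nil; split.
      by apply: eq_integrable (integrable0 mu setT) => // t _ /=; rewrite big_nil.
    by under eq_Rintegral do rewrite big_nil; rewrite Rintegral_cst// mul0r.
  have [ix ex] := step1 x (c x); split.
    apply: eq_integrable (integrableD measurableT ix ir) => // t _.
    by rewrite /= big_cons EFinD.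
  under eq_Rintegral do rewrite big_cons.
  by rewrite RintegralD// ex er big_cons.
have expand (g : G -> R) : (forall t t', subgroup_set V (t^-1 * t')%g -> g t = g t') ->
    (forall t, g t != 0 -> C t) ->
    g = fun t => \sum_(x <- s) g x * \1_(lcoset x V) t.
  move=> gV gC; apply/funext => t.
  have [Ct|nCt] := pselect (exists2 x, x \in s & subgroup_set V (x^-1 * t)%g); last first.
    rewrite big1_seq; first by apply/eqP/negP => /negP/gC/sCV.
    move=> x /= /[dup] xs; rewrite indicE memNset ?mulr0// lcosetE /= => Vxt.
    by apply: nCt; exists x.
  have [x xs Vxt] := Ct; rewrite (bigD1_seq x)//= big1_seq.
    by rewrite indicE mem_set ?mulr1 ?addr0 ?lcosetE//; apply/esym/gV.
  move=> y /andP[yx ys]; rewrite indicE memNset ?mulr0// lcosetE /= => Vyt.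
  move/eqP: yx; apply; apply: sV => //.
  have := subgroupM Vyt (subgroupV Vxt).
  by rewrite invgM invgK mulgA mulgK.
have Re_fV t t' : subgroup_set V (t^-1 * t')%g ->
    complex.Re (f t) = complex.Re (f t') by move=> /fV ->.
have Im_fV t t' : subgroup_set V (t^-1 * t')%g ->
    complex.Im (f t) = complex.Im (f t') by move=> /fV ->.
have Re_fC t : complex.Re (f t) != 0 -> C t.
  by move=> ft; apply: fC; apply: contraNneq ft => ->.
have Im_fC t : complex.Im (f t) != 0 -> C t.
  by move=> ft; apply: fC; apply: contraNneq ft => ->.
rewrite /complex_integral (expand _ Re_fV Re_fC) (expand _ Im_fV Im_fC).
rewrite (stepn _).2 (stepn _).2.
elim: (s) => [|x r IH]; first by rewrite !big_nil.
rewrite !big_cons -IH; case: (f x) => a b; apply/eqP; rewrite eq_complex /=.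
by rewrite !mulr0 subr0 add0r !eqxx.
Qed.

End BorelIntegral.

(** * Open subgroups *)

Section OpenSubgroups.
Variable G : topologicalGroupType.

(** Known as the non-archimedean property; [completion_small_open] provides it for the
    completion. *)
Definition small_open_subgroups := forall U : set G, nbhs 1%g U ->
  exists2 V : subgroup G, open (V : set G) & (V : set G) `<=` U.

Lemma nbhs_open_subgroup (V : subgroup G) : open (V : set G) -> nbhs 1%g (V : set G).
Proof. by move=> oV; apply: open_nbhs_nbhs; split=> //; exact: subgroup1. Qed.

Lemma nbhs_lcoset (V : subgroup G) (x : G) :
  open (V : set G) -> nbhs x (lcoset x V).
Proof.
move=> oV; apply: open_nbhs_nbhs; split; first exact: open_lcoset.
by rewrite lcosetE /= mulVg; exact: subgroup1.
Qed.

Lemma open_subgroup_closed (V : subgroup G) : open (V : set G) -> closed (V : set G).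
Proof.
move=> oV x /(_ _ (nbhs_lcoset x oV)) [y [Vy]]; rewrite lcosetE /= => Vxy.
have := subgroupM Vy (subgroupV Vxy).
by rewrite invgM invgK mulgA mulgV mul1g.
Qed.

Lemma compact_coset_reps (V : subgroup G) (C : set G) :
  open (V : set G) -> compact C -> exists s, coset_reps (subgroup_set V) C s.
Proof.
move=> oV; rewrite compact_cover => /(_ _ C (fun x => lcoset x V)) [|x Cx|D DC CD].
- by move=> x _; exact: open_lcoset.
- by exists x => //; rewrite lcosetE /= mulVg; exact: subgroup1.
(* [Q d] depends only on the coset d V, so [get] picks the same point for equal cosets, and removing
   duplicates leaves one representative for each coset. *)
pose Q d := [set y | C y /\ subgroup_set V (d^-1 * y)%g].
pose r d : G := get (Q d).
exists (undup [seq r d | d <- D & d \in C]).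
have rP d : C d -> Q d (r d).
  by move=> Cd; apply: (@getI _ (Q d) d); split=> //; rewrite mulVg; exact: subgroup1.
split; first exact: undup_uniq.
- move=> x; rewrite mem_undup => /mapP[d]; rewrite mem_filter => /andP[/set_mem/rP[Cr _] _] ->.
  by [].
- move=> x y; rewrite !mem_undup => /mapP[d]; rewrite mem_filter.
  move=> /andP[/set_mem/rP[_ Vd] _] -> /mapP[d']; rewrite mem_filter.
  move=> /andP[/set_mem/rP[_ Vd'] _] -> Vr.
  suff QQ : Q d = Q d' by rewrite /r QQ.
  have Vdd : subgroup_set V (d^-1 * d')%g.
    have := subgroupM (subgroupM Vd Vr) (subgroupV Vd').
    by rewrite invgM invgK !mulgA mulgK mulgK.
  apply/seteqP; split=> y' [Cy' Vy']; split=> //.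
    have := subgroupM (subgroupV Vdd) Vy'.
    by rewrite invgM invgK !mulgA mulgK.
  by have := subgroupM Vdd Vy'; rewrite !mulgA mulgK.
- move=> c Cc; have [d Dd dc] := CD c Cc.
  have Cd : C d by have := DC d Dd; rewrite inE.
  exists (r d).
    by rewrite mem_undup; apply/mapP; exists d => //; rewrite mem_filter Dd mem_set.
  have [_ Vr] := rP d Cd; move: dc; rewrite lcosetE /= => Vdc.
  have := subgroupM (subgroupV Vr) Vdc.
  by rewrite invgM invgK !mulgA mulgK.
Qed.

Lemma compact_mulg (A B : set G) : compact A -> compact B ->
  compact [set (ab.1 * ab.2)%g | ab in A `*` B].
Proof.
move=> cA cB; apply: continuous_compact; last exact: compact_setX.
by apply: continuous_subspaceT; exact: mulg_continuous.
Qed.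

Section LocallyConstant.
Variable T : topologicalType.

Definition right_invariant (V : set G) (f : G -> T) :=
  forall t w, V w -> f (t * w)%g = f t.

Definition left_invariant (V : set G) (f : G -> T) :=
  forall w t, V w -> f (w * t)%g = f t.

Lemma right_invariant_continuous (V : subgroup G) (f : G -> T) :
  open (V : set G) -> right_invariant V f -> continuous f.
Proof.
move=> oV fV x; apply: (@cvg_near_cst _ _ (f x) f _ (nbhs_filter x)).
by apply: filterS (nbhs_lcoset x oV) => _ [w Vw <-]; rewrite fV.
Qed.

Lemma left_invariant_continuous (V : subgroup G) (f : G -> T) :
  open (V : set G) -> left_invariant V f -> continuous f.
Proof.
move=> oV fV x; apply: (@cvg_near_cst _ _ (f x) f _ (nbhs_filter x)).
have : nbhs x ((fun t => t * x^-1)%g @^-1` subgroup_set V).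
  by apply: continuous_mulgr; rewrite mulgV; exact: nbhs_open_subgroup.
apply: filterS => y /= Vy.
by rewrite -(fV _ x Vy) mulgVK.
Qed.

End LocallyConstant.

(** * Uniform approximation by functions bi-invariant under an open subgroup *)

Section BiInvariantApproximation.
Variable R : realType.
Hypothesis small : small_open_subgroups.

Lemma open_double_coset (V : subgroup G) (x : G) : open (V : set G) ->
  open [set y | exists w w', [/\ subgroup_set V w, subgroup_set V w'
                               & y = (w * x * w')%g]].
Proof.
move=> oV; rewrite (_ : [set y | _] = \bigcup_(w in subgroup_set V) lcoset (w * x)%g V).
  by apply: bigcup_open => w _; exact: open_lcoset.
apply/seteqP; split=> [_ [w [w' [Vw Vw' ->]]]|_ [w Vw [w' Vw' <-]]].
  by exists w => //; exists w'.
by exists w, w'.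
Qed.

Lemma double_coset_nbhs (x : G) (U : set G) : nbhs x U ->
  exists2 V : subgroup G, open (V : set G) &
    forall w w', subgroup_set V w -> subgroup_set V w' -> U (w * x * w')%g.
Proof.
move=> Ux; have := @mulg_continuous G (1%g, x) U.
rewrite /= mul1g => /(_ Ux) [[A B] /= [A1 Bx] ABU].
have xB : nbhs 1%g ((fun t => x * t)%g @^-1` B).
  by apply: continuous_mulgl; rewrite mulg1.
have [V oV VAB] := small (filterI A1 xB).
exists V => // w w' /VAB[Aw _] /VAB[_ Bw']; rewrite -mulgA.
exact: (ABU (w, x * w')%g).
Qed.

(** Around each t, f oscillates by less than e/2 on a double coset V_t t V_t. Finitely many of these
    cover the support, and a W inside the corresponding V_t keeps w t w' in the double coset of
    t. *)
Lemma uniform_continuity (f : G -> Cplx R) (e : Cplx R) :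
  compactly_supported f -> 0 < e ->
  exists2 V : subgroup G, open (V : set G) &
    forall w w' t, subgroup_set V w -> subgroup_set V w' ->
      `|f (w * t * w')%g - f t| < e.
Proof.
move=> [cf [K cK fK]] e0.
have e20 : 0 < e / 2 by rewrite divr_gt0.
have /choice[V HV] : forall t : G, exists V : subgroup G, open (V : set G) /\
    forall w w', subgroup_set V w -> subgroup_set V w' ->
      `|f t - f (w * t * w')%g| < e / 2.
  move=> t.
  have nb : nbhs t [set s | `|f t - f s| < e / 2].
    by have /cvgrPdist_lt := cf t; exact.
  have [V oV HV] := double_coset_nbhs nb.
  by exists V.
pose dc t : set G := [set y | exists w w', [/\ subgroup_set (V t) w, subgroup_set (V t) w'
                               & y = (w * t * w')%g]].
have := cK; rewrite compact_cover => /(_ _ K dc) [t _|t Kt|D DK KD].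
- by apply: open_double_coset; have [] := HV t.
- exists t => //; exists 1%g, 1%g; split; try exact: subgroup1.
  by rewrite mul1g mulg1.
have nW : nbhs (1%g : G) (\bigcap_(t in [set` D]) subgroup_set (V t)).
  by apply: filter_bigI => t _; apply: nbhs_open_subgroup; have [] := HV t.
have [W oW WV] := small nW.
have main w w' t : subgroup_set W w -> subgroup_set W w' -> K t ->
    `|f (w * t * w')%g - f t| < e.
  move=> /WV Ww /WV Ww' /KD[d Dd [v [v' [Vv Vv' ->]]]].
  have [_ Vd] := HV d.
  rewrite -[X in X - _](subrK (f d)) -addrA.
  apply: le_lt_trans (ler_normD _ _) _.
  rewrite (splitr e) ltrD//; last exact: Vd.
  rewrite distrC !mulgA -(mulgA (w * v * d)%g).
  by apply: Vd; apply: subgroupM => //; [exact: Ww|exact: Ww'].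
exists W => // w w' t Ww Ww'.
(* For t outside K, either w t w' is outside too and both values vanish, or the estimate applies at
   w t w' with the inverses of w and w'. *)
have [Kt|nKt] := pselect (K t); first exact: main.
have [Kt'|nKt'] := pselect (K (w * t * w')%g); last first.
  by rewrite !fK// subrr normr0.
rewrite distrC; have := main _ _ _ (subgroupV Ww) (subgroupV Ww') Kt'.
by rewrite !mulgA mulVg mul1g mulgK.
Qed.

Definition bi_invariant (V : set G) (f : G -> Cplx R) :=
  left_invariant V f /\ right_invariant V f.

(** The compact set H K H is fixed before e: as V is taken inside H, it contains the supports of f
    and of every f'. A uniform estimate thus becomes a norm estimate with a constant independent of
    e. *)
Lemma bi_invariant_approximation (H : subgroup G) (f : G -> Cplx R) :
  open (H : set G) -> compact (H : set G) -> compactly_supported f ->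
  exists2 K : set G, compact K & forall e : Cplx R, 0 < e ->
    exists (V : subgroup G) (f' : G -> Cplx R),
      [/\ open (V : set G), compactly_supported f', bi_invariant V f',
        forall t, `|f t - f' t| <= e & forall t, ~ K t -> f t = 0 /\ f' t = 0].
Proof.
move=> oH cH cf; have [_ [K cK fK]] := cf.
pose HK := [set (ab.1 * ab.2)%g | ab in subgroup_set H `*` K].
pose HKH := [set (ab.1 * ab.2)%g | ab in HK `*` subgroup_set H].
have cHKH : compact HKH by apply: compact_mulg => //; exact: compact_mulg.
exists HKH => // e e0.
have [W oW fW] := uniform_continuity cf e0.
have [V oV VWH] := small (filterI (nbhs_open_subgroup oW) (nbhs_open_subgroup oH)).
pose dc t : set G := [set y | exists w w', [/\ subgroup_set V w, subgroup_set V w'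
                               & y = (w * t * w')%g]].
have dct t : dc t t.
  exists 1%g, 1%g; split; try exact: subgroup1.
  by rewrite mul1g mulg1.
have dcE t w w' : subgroup_set V w -> subgroup_set V w' -> dc (w * t * w')%g = dc t.
  move=> Vw Vw'; apply/seteqP; split=> _ [v [v' [Vv Vv' ->]]].
    exists (v * w)%g, (w' * v')%g; split; try exact: subgroupM.
    by rewrite !mulgA.
  exists (v * w^-1)%g, (w'^-1 * v')%g.
  split; [by apply: subgroupM => //; exact: subgroupV.. |].
  by rewrite !mulgA mulgVK mulgK.
(* [f'] takes on each double coset of [V] the value of [f] at a chosen point. *)
pose r t : G := get (dc t).
have rP t : dc t (r t) := getI (dct t).
pose f' t := f (r t).
have f'V : bi_invariant V f'.
  split=> [w t Vw|t w Vw]; rewrite /f' /r.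
    by rewrite -(mulg1 (w * t)%g) dcE//; exact: subgroup1.
  by rewrite -(mul1g t) dcE ?mul1g//; exact: subgroup1.
have KH t : K t -> HKH t.
  move=> Kt; exists (t, 1%g); last by rewrite /= mulg1.
  split; last exact: subgroup1.
  by exists (1%g, t); [split=> //; exact: subgroup1|rewrite /= mul1g].
have f'0 t : ~ HKH t -> f' t = 0.
  move=> nt; rewrite /f'; apply: fK => Kr; apply: nt.
  have [w [w' [Vw Vw' rE]]] := rP t.
  exists (w^-1 * r t, w'^-1)%g; last by rewrite /= rE !mulgA mulVg mul1g mulgK.
  split=> /=; last by apply: subgroupV; have [] := VWH _ Vw'.
  by exists (w^-1, r t)%g => //; split=> //=; apply: subgroupV; have [] := VWH _ Vw.
exists V, f'; split=> //.
- split; first exact: left_invariant_continuous oV f'V.1.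
  by exists HKH.
- move=> t; have [w [w' [Vw Vw' rE]]] := rP t; rewrite distrC /f' rE ltW//.
  by apply: fW; [have [] := VWH _ Vw|have [] := VWH _ Vw'].
- by move=> t nt; split; [apply: fK => /KH|exact: f'0].
Qed.

End BiInvariantApproximation.

End OpenSubgroups.

(** * The translation action on the group C*-algebra *)

Section HilbertFacts.
Variables (R : realType) (V : hilbertType R).
Implicit Types x y z : V.

Lemma ipDl x y z : ip (x + y) z = ip x z + ip y z.
Proof. by have := ip_linear z 1 x y; rewrite scale1r mul1r. Qed.

Lemma ip0l z : ip 0 z = 0.
Proof. by apply: (addrI (ip 0 z)); rewrite -ipDl !addr0. Qed.

Lemma ipZl (c : Cplx R) x z : ip (c *: x) z = c * ip x z.
Proof. by have := ip_linear z c x 0; rewrite !addr0 ip0l addr0. Qed.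

Lemma ipBl x y z : ip (x - y) z = ip x z - ip y z.
Proof. by rewrite ipDl -scaleN1r ipZl mulN1r. Qed.

Lemma ipZr (c : Cplx R) x z : ip x (c *: z) = c^* * ip x z.
Proof. by rewrite ip_conj ipZl rmorphM /= -ip_conj. Qed.

Lemma ipBr x y z : ip z (x - y) = ip z x - ip z y.
Proof. by rewrite ip_conj ipBl rmorphB /= -!ip_conj. Qed.

Lemma norm_ip_le1 x y : `|x| <= 1 -> `|y| <= 1 -> `|ip x y| <= 1.
Proof.
move=> x1 y1; have [->|z0] := eqVneq (ip x y) 0; first by rewrite normr0.
set z := ip x y in z0 *; pose c := z^* / `|z|.
have nz0 : `|z| != 0 by rewrite normr_eq0.
have c1 : `|c| = 1 by rewrite normrM normfV norm_conjC normr_id divff.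
have zE : ip (c *: x) y = `|z|.
  by rewrite ipZl -/z /c mulrAC [_^* * _]mulrC -normCK expr2 mulfK.
(* [c] has modulus 1 and <c x, y> = |<x, y>|: expand |c x - y|^2 >= 0. *)
have := exprn_ge0 2 (normr_ge0 (c *: x - y)).
rewrite -ip_norm ipBl !ipBr (ip_conj (c *: x) y) zE conj_normC !ip_norm normrZ c1 mul1r.
rewrite opprB addrA => h.
have x2 : `|x| ^+ 2 <= 1 by rewrite exprn_ile1.
have y2 : `|y| ^+ 2 <= 1 by rewrite exprn_ile1.
have : `|z| *+ 2 <= 1 *+ 2.
  rewrite mulr2n -subr_ge0; apply: le_trans h _.
  rewrite -subr_ge0 (_ : _ - _ = (1 - `|x| ^+ 2) + (1 - `|y| ^+ 2)); last by ring.
  by rewrite addr_ge0// subr_ge0.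
by rewrite lerMn2r.
Qed.

Lemma norm_ip_le x y : `|ip x y| <= `|x| * `|y|.
Proof.
have [->|x0] := eqVneq x 0; first by rewrite ip0l !normr0 mul0r.
have [->|y0] := eqVneq y 0.
  by rewrite ip_conj ip0l rmorph0 !normr0 mulr0.
have := @norm_ip_le1 (`|x|^-1 *: x) (`|y|^-1 *: y).
rewrite !normrZ !normfV !normr_id !mulVf ?normr_eq0// => /(_ (lexx _) (lexx _)).
rewrite ipZl ipZr !normrM norm_conjC !normfV !normr_id mulrA -invfM mulrC.
by rewrite ler_pdivrMr ?mul1r// mulr_gt0// normr_gt0.
Qed.

End HilbertFacts.

Section RepresentationCoefficients.
Variables (R : realType) (G : topologicalGroupType) (V : hilbertType R).
Variable pi : G -> V -> V.
Hypothesis pi_rep : unitary_representation pi.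

Lemma rep_norm (g : G) (x : V) : `|pi g x| = `|x|.
Proof.
apply/eqP; rewrite -(@eqrXn2 _ 2)// -!ip_norm.
by rewrite (rep_ip pi_rep).
Qed.

Lemma coefficient_continuous (x y : V) : continuous (fun g => ip (pi g x) y).
Proof.
move=> g; apply/cvgrPdist_lt => e e0.
(* The summand 1 keeps the denominator positive when y = 0; the same device recurs below. *)
have e'0 : 0 < e / (`|y| + 1) by rewrite divr_gt0// ltr_wpDl.
have /cvgrPdist_lt/(_ _ e'0) := @rep_continuous _ _ _ _ pi_rep x g.
apply: filterS => h; rewrite -ipBl => xh; apply: le_lt_trans (norm_ip_le _ _) _.
move: xh; rewrite ltr_pdivlMr ?ltr_wpDl//; apply: le_lt_trans.
by rewrite ler_wpM2l// lerDl.
Qed.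

End RepresentationCoefficients.

Section CompactlySupported.
Variables (R : realType) (G : topologicalGroupType).
Implicit Types f g : G -> Cplx R.

Lemma compactly_supported0 : compactly_supported (fun _ : G => 0 : Cplx R).
Proof. by split; [exact: cst_continuous|exists set0; [exact: compact0|]]. Qed.

Lemma compactly_supported_linear (c : Cplx R) f g :
  compactly_supported f -> compactly_supported g ->
  compactly_supported (fun t => c * f t + g t).
Proof.
move=> [cf [K cK fK]] [cg [L cL gL]]; split.
  by move=> t; apply: cvgD; [apply: cvgM; [exact: cvg_cst|exact: cf]|exact: cg].
exists (K `|` L); first exact: compactU.
by move=> x KLx; rewrite fK ?gL ?mulr0 ?addr0// => ?; apply: KLx; [right|left].
Qed.

Lemma compactly_supported_translate f (s : G) : compactly_supported f ->
  compactly_supported (fun t => f (s^-1 * t)%g).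
Proof.
move=> [cf [K cK fK]]; split.
  by move=> t; apply: (continuous_comp (@continuous_mulgl G s^-1%g t)); exact: cf.
exists (lcoset s K).
  rewrite (_ : lcoset s K = [set (s * t)%g | t in K])//.
  apply: continuous_compact => //; apply: continuous_subspaceT.
  exact: continuous_mulgl.
by move=> x; rewrite lcosetE => /fK.
Qed.

Lemma compactly_supported_sum (I : Type) (r : seq I) (c : I -> Cplx R)
    (f : I -> G -> Cplx R) : (forall i, compactly_supported (f i)) ->
  compactly_supported (fun t => \sum_(i <- r) c i * f i t).
Proof.
move=> cf; elim: r => [|i r IH].
  rewrite (_ : (fun t => _) = fun=> 0); first exact: compactly_supported0.
  by apply/funext => t; rewrite big_nil.
rewrite (_ : (fun t => _) = fun t => c i * f i t + \sum_(j <- r) c j * f j t).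
  exact: compactly_supported_linear.
by apply/funext => t; rewrite big_cons.
Qed.

Lemma left_invariant_translate f (V W : subgroup G) (s : G) :
  (forall w, subgroup_set W w -> subgroup_set V (s^-1 * w * s)%g) ->
  left_invariant V f -> left_invariant W (fun t => f (s^-1 * t)%g).
Proof.
move=> WV fV w t Ww; have := fV _ (s^-1 * t)%g (WV w Ww).
by rewrite !mulgA mulgK.
Qed.

Lemma compactly_supported_bounded f : compactly_supported f ->
  exists c : R, forall t, `|f t| <= real_complex R c.
Proof.
move=> [cf [K cK fK]].
have bnd (h : Cplx R -> R) : h 0 = 0 -> continuous h ->
    exists c : R, forall t, `|h (f t)| <= c.
  move=> h0 ch; pose hf : G -> R^o := h \o f.
  have chf : continuous hf by move=> t; apply: continuous_comp; [exact: cf|exact: ch].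
  have : compact (hf @` K).
    by apply: continuous_compact => //; exact: continuous_subspaceT.
  move=> /compact_bounded[M [_ HM]]; exists (`|M| + 1) => t.
  have [Kt|nKt] := pselect (K t).
    apply: HM; last by exists t.
    by rewrite (le_lt_trans (ler_norm _))// ltrDl.
  by rewrite fK// h0 normr0 addr_ge0.
have [c1 H1] := bnd (fun z => complex.Re z) erefl (@continuous_Re R).
have [c2 H2] := bnd (fun z => complex.Im z) erefl (@continuous_Im R).
exists (c1 + c2) => t; apply: le_trans (norm_le_Re_Im _) _.
by rewrite ler_real_complex; apply: lerD; [exact: H1|exact: H2].
Qed.

End CompactlySupported.

(** * Linear maps given as bare functions *)

Section BoundedOperators.
Variables (K : numFieldType) (V W : normedModType K) (f : V -> W).
Hypothesis f_linear : linear f.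

Lemma linear_subtraction x y : f (x - y) = f x - f y.
Proof. by rewrite addrC -scaleN1r f_linear scaleN1r addrC. Qed.

Lemma linear_zero : f 0 = 0.
Proof. by rewrite -(subrr 0) linear_subtraction subrr. Qed.

Lemma linear_scaling c x : f (c *: x) = c *: f x.
Proof. by rewrite -[c *: x]addr0 f_linear linear_zero addr0. Qed.

Lemma linear_addition x y : f (x + y) = f x + f y.
Proof. by rewrite -[x]scale1r f_linear !scale1r. Qed.

Lemma linear_summation (I : Type) (r : seq I) (F : I -> V) :
  f (\sum_(i <- r) F i) = \sum_(i <- r) f (F i).
Proof.
by elim: r => [|i r IH]; rewrite ?big_nil ?linear_zero// !big_cons linear_addition IH.
Qed.

Lemma linear_continuous_bounded : continuous f ->
  exists2 k : K, 0 < k & forall x, `|f x| <= k * `|x|.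
Proof.
move=> cf; have /cvgrPdist_lt/(_ _ ltr01) := cf 0.
(* A vector is rescaled to norm d / 2, strictly inside the ball of radius d on which |f| < 1. *)
move=> /nbhs_norm0P[d /= d0 fd]; exists (2 / d); first by rewrite divr_gt0.
move=> x; have [->|x0] := eqVneq x 0; first by rewrite linear_zero !normr0 mulr0.
have nx0 : 0 < `|x| by rewrite normr_gt0.
set c := d / 2 / `|x|; have cx : c * `|x| = d / 2 by rewrite mulfVK ?gt_eqF.
have c0 : 0 < c by rewrite !divr_gt0.
have cV : c^-1 = 2 / d * `|x| by rewrite !invf_div mulrC.
have := fd (c *: x); rewrite /= linear_zero sub0r normrN linear_scaling !(normrZ c).
rewrite (gtr0_norm c0) cx gtr_pMr// invf_lt1 ?ltr1n// => /(_ isT)/ltW.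
by rewrite -ler_pdivlMl// mulr1 cV.
Qed.

End BoundedOperators.

(** * Estimates drawn from the universal norm *)

Section GroupAlgebra.
Variables (R : realType) (G : topologicalGroupType).
Variable mu : {measure set (borel G) -> \bar R}.
Variable Delta : G -> R.
Variables (A : cstarAlgebraType R) (iota : (G -> Cplx R) -> A).
Variable u : G -> multiplier A.
Hypothesis G_hausdorff : hausdorff_space G.
Hypothesis mu_haar : left_haar_measure mu.
Hypothesis iotaP : group_cstar_algebra mu Delta iota.
Hypothesis uP : canonical_multipliers iota u.

Local Notation cs := (@compactly_supported R G).
Local Notation lam s := (lmul (u s)).

Lemma iota0 : iota (fun _ => 0) = 0.
Proof.
have c0 := @compactly_supported0 R G.
have := iota_linear iotaP (-1) c0 c0.
by rewrite scaleN1r addNr mulr0 addr0.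
Qed.

Lemma iota_sum (I : Type) (r : seq I) (c : I -> Cplx R) (f : I -> G -> Cplx R) :
  (forall i, cs (f i)) ->
  iota (fun t => \sum_(i <- r) c i * f i t) = \sum_(i <- r) c i *: iota (f i).
Proof.
move=> cf; elim: r => [|i r IH].
  rewrite big_nil -[RHS]iota0; congr iota.
  by apply/funext => t; rewrite big_nil.
rewrite big_cons -IH -(iota_linear iotaP)//; last exact: compactly_supported_sum.
by congr iota; apply/funext => t; rewrite big_cons.
Qed.

Lemma iotaB (f g : G -> Cplx R) : cs f -> cs g ->
  iota (fun t => f t - g t) = iota f - iota g.
Proof.
move=> cf cg; rewrite addrC -scaleN1r -(iota_linear iotaP)//.
by congr iota; apply/funext => t; rewrite mulN1r addrC.
Qed.

Lemma iota_le (f : G -> Cplx R) (b : Cplx R) : cs f ->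
  (forall r, universal_norm_set mu f r -> r <= b) -> `|iota f| <= b.
Proof. by move=> cf fb; have [_] := iota_norm iotaP cf; apply. Qed.

Lemma coefficient_integral_bound (f : G -> Cplx R) (K : set G) (c : R)
    (V : hilbertType R) (pi : G -> V -> V) (x y : V) :
  cs f -> compact K ->
  (forall t, `|f t| <= real_complex R c) -> (forall t, ~ K t -> f t = 0) ->
  unitary_representation pi -> `|x| <= 1 -> `|y| <= 1 ->
  cintegrable mu (fun t => f t * ip (pi t x) y) /\
  `|complex_integral mu (fun t => f t * ip (pi t x) y)| <=
    real_complex R (2 * c * fine (mu K)).
Proof.
move=> cf cK fc fK rep_pi x1 y1.
have mK : measurable (K : set (borel G)).
  rewrite -(setCK K); apply: measurableC; apply: borel_open.
  exact: (closed_openC (compact_closed G_hausdorff cK)).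
apply: complex_integral_bound => //.
- by move=> t; apply: cvgM; [exact: cf.1|exact: coefficient_continuous].
- exact: haar_compact.
- move=> t; rewrite normrM -[leRHS]mulr1 ler_pM//.
  by apply: norm_ip_le1 => //; rewrite (rep_norm rep_pi).
- by move=> t nKt; rewrite fK// mul0r.
Qed.

(** A crude form of the L^1 bound: coefficients of unit vectors are at most 1 in modulus, so the
    estimate is uniform over all unitary representations. *)
Lemma iota_bound (f : G -> Cplx R) (K : set G) (c : R) : cs f -> compact K ->
  (forall t, `|f t| <= real_complex R c) -> (forall t, ~ K t -> f t = 0) ->
  `|iota f| <= real_complex R (2 * c * fine (mu K)).
Proof.
move=> cf cK fc fK; apply: iota_le => // _ [V [pi [x [y [rep_pi x1 y1 ->]]]]].
by have [] := coefficient_integral_bound cf cK fc fK rep_pi x1 y1.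
Qed.

(** By left invariance, the coefficient of the translate at (x, y) is that of f at (x, pi(s^-1) y),
    and pi(s^-1) preserves the norm of y. *)
Lemma iota_translate_le (f : G -> Cplx R) (s : G) : cs f ->
  `|iota (fun t => f (s^-1 * t)%g)| <= `|iota f|.
Proof.
move=> cf; have csf := compactly_supported_translate s cf.
apply: iota_le => // _ [V [pi [x [y [rep_pi x1 y1 ->]]]]].
have [ub _] := iota_norm iotaP cf; apply: ub.
exists V, pi, x, (pi s^-1%g y); split=> //; first by rewrite (rep_norm rep_pi).
congr `|_|.
pose F t := f t * ip (pi t x) (pi s^-1%g y).
have FE : (fun t => f (s^-1 * t)%g * ip (pi t x) y) = (fun t => F (s^-1 * t)%g).
  by apply/funext => t; rewrite /F (repM rep_pi) (rep_ip rep_pi).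
have [_ [K cK fK]] := csf; have [c fc] := compactly_supported_bounded csf.
have [iF _] := coefficient_integral_bound csf cK fc fK rep_pi x1 y1.
rewrite FE; apply: complex_integral_translate => //; last by rewrite -FE.
by move=> t; apply: cvgM; [exact: cf.1|exact: coefficient_continuous].
Qed.

Lemma iota_dense_approx (a : A) (e : Cplx R) : 0 < e ->
  exists2 f, cs f & `|a - iota f| < e.
Proof.
move=> e0; have : closure (iota @` [set f | cs f]) a by rewrite (iota_dense iotaP).
move=> /(_ _ (nbhsx_ballx a _ e0))[_ [[f cf <-]]].
by rewrite -ball_normE; exists f.
Qed.

(** A multiplier is only known to be bounded by some k. On the dense image of [iota] translation is
    contractive, and approximation replaces k by 1; the error (k + 1) |a - iota f| explains the
    choice of f. *)
Lemma lam_le (s : G) (a : A) : `|lam s a| <= `|a|.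
Proof.
have [k k0 lk] := linear_continuous_bounded (lmul_linear (u s)) (@lmul_continuous _ _ (u s)).
apply/ler_addgt0Pr => e e0.
have [f cf af] := iota_dense_approx a (divr_gt0 e0 (addr_gt0 k0 ltr01)).
have lamB : lam s (a - iota f) = lam s a - lam s (iota f).
  exact: linear_subtraction (lmul_linear (u s)) _ _.
have -> : lam s a = lam s (a - iota f) + lam s (iota f) by rewrite lamB subrK.
apply: le_trans (ler_normD _ _) _; rewrite (uP s cf).
apply: le_trans (lerD (lk _) (iota_translate_le s cf)) _.
have nf : `|iota f| <= `|a| + `|a - iota f|.
  by rewrite -{1}(subKr a (iota f)) ler_normB.
apply: le_trans (lerD (lexx _) nf) _; rewrite addrCA lerD2l.
have -> : k * `|a - iota f| + `|a - iota f| = `|a - iota f| * (k + 1).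
  by rewrite mulrDr mulr1 mulrC.
by rewrite -ler_pdivlMr ?addr_gt0// ltW.
Qed.

End GroupAlgebra.

Section DenseEquality.
Variables (K : numFieldType) (V W : normedModType K).

(** The difference F1 a - F2 a is bounded by (k1 + k2) |a - d| for every d in D. Lipschitz bounds
    suffice, so the maps may be compositions not known to be linear. *)
Lemma dense_equality (D : set V) (F1 F2 : V -> W) (k1 k2 : K) :
  (forall a e, 0 < e -> exists2 d, D d & `|a - d| < e) ->
  0 <= k1 -> 0 <= k2 ->
  (forall x y, `|F1 x - F1 y| <= k1 * `|x - y|) ->
  (forall x y, `|F2 x - F2 y| <= k2 * `|x - y|) ->
  (forall d, D d -> F1 d = F2 d) -> F1 =1 F2.
Proof.
move=> dD k10 k20 l1 l2 FD a; apply/eqP; rewrite -subr_eq0 -normr_le0.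
have k0 : 0 < k1 + k2 + 1 by rewrite ltr_wpDl// addr_ge0.
apply/ler_addgt0Pr => e e0; rewrite add0r.
have [d Dd ad] := dD a (e / (k1 + k2 + 1)) (divr_gt0 e0 k0).
rewrite -(subrKA (F1 d)) [in X in _ + X](FD _ Dd).
apply: le_trans (ler_normD _ _) _; rewrite [X in _ + X]distrC.
apply: le_trans (lerD (l1 _ _) (l2 _ _)) _; rewrite -mulrDl mulrC.
move/ltW: ad; rewrite ler_pdivlMr//; apply: le_trans.
by rewrite ler_wpM2l// lerDl.
Qed.

End DenseEquality.

Section TranslationAction.
Variables (R : realType) (G : topologicalGroupType).
Variable mu : {measure set (borel G) -> \bar R}.
Variable Delta : G -> R.
Variables (A : cstarAlgebraType R) (iota : (G -> Cplx R) -> A).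
Variable u : G -> multiplier A.
Hypothesis G_hausdorff : hausdorff_space G.
Hypothesis mu_haar : left_haar_measure mu.
Hypothesis iotaP : group_cstar_algebra mu Delta iota.
Hypothesis uP : canonical_multipliers iota u.

Local Notation cs := (@compactly_supported R G).
Local Notation lam s := (lmul (u s)).

Lemma lamB s (a b : A) : lam s (a - b) = lam s a - lam s b.
Proof. exact: linear_subtraction (lmul_linear (u s)) _ _. Qed.

Lemma lam_lipschitz s (a b : A) : `|lam s a - lam s b| <= 1 * `|a - b|.
Proof. by rewrite mul1r -lamB; exact: (lam_le G_hausdorff mu_haar iotaP uP). Qed.

Lemma iota_dense_image (a : A) (e : Cplx R) : 0 < e ->
  exists2 d, (iota @` [set f | cs f]) d & `|a - d| < e.
Proof.
move=> /(iota_dense_approx iotaP a)[f cf af].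
by exists (iota f) => //; exists f.
Qed.

Lemma lamM s t (a : A) : lam s (lam t a) = lam (s * t)%g a.
Proof.
apply: (dense_equality (k1 := 1) (k2 := 1) (F1 := fun a => lam s (lam t a))
  iota_dense_image) => //.
- move=> x y; apply: le_trans (lam_lipschitz _ _ _) _; rewrite mul1r.
  exact: lam_lipschitz.
- exact: lam_lipschitz.
- move=> _ [f cf <-]; rewrite !(uP _ cf) (uP _ (compactly_supported_translate t cf)).
  by congr iota; apply/funext => r; rewrite invgM mulgA.
Qed.

Lemma lam1 (a : A) : lam 1%g a = a.
Proof.
apply: (dense_equality (k1 := 1) (k2 := 1) (F2 := id) iota_dense_image) => //.
- exact: lam_lipschitz.
- by move=> x y; rewrite mul1r.
- move=> _ [f cf <-]; rewrite (uP _ cf).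
  by congr iota; apply/funext => r; rewrite invg1 mul1g.
Qed.

(** More than a vector fixed by V: it carries an invariant function, so that products with it can be
    computed as convolutions. *)
Definition fixed_element (V : set G) (b : A) :=
  exists f, [/\ cs f, left_invariant V f & b = iota f].

Lemma fixed_element_lam (V : set G) (b : A) v :
  fixed_element V b -> V v^-1%g -> lam v b = b.
Proof.
move=> [f [cf fV ->]] Vv; rewrite (uP _ cf); congr iota.
by apply/funext => t; rewrite fV.
Qed.

Lemma fixed_element_translate (V W : subgroup G) (s : G) (b : A) :
  (forall w, subgroup_set W w -> subgroup_set V (s^-1 * w * s)%g) ->
  fixed_element V b -> fixed_element W (lam s b).
Proof.
move=> WV [f [cf fV ->]]; exists (fun t => f (s^-1 * t)%g); split.
- exact: compactly_supported_translate.
- exact: left_invariant_translate fV.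
- exact: uP.
Qed.

(** The integrand f(r) g(r^-1 t) is constant on each coset r W. On W-invariant elements,
    multiplication by [iota f] is therefore a finite combination of translations. *)
Lemma convolution_coset_sum (W : subgroup G) (f g : G -> Cplx R) (C : set G) s :
  open (W : set G) -> (mu (subgroup_set W) < +oo)%E -> cs f -> cs g ->
  right_invariant W f -> left_invariant W g ->
  coset_reps W C s -> (forall t, f t != 0 -> C t) ->
  cmul (iota f) (iota g) =
    \sum_(x <- s) (real_complex R (fine (mu (subgroup_set W))) * f x) *: lam x (iota g).
Proof.
move=> oW Wfin cf cg fW gW sC fC; rewrite -(iotaM iotaP)//.
transitivity (\sum_(x <- s) (real_complex R (fine (mu (subgroup_set W))) * f x) *:
    iota (fun t => g (x^-1 * t)%g)); last by apply: eq_bigr => x _; rewrite (uP _ cg).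
rewrite -(iota_sum iotaP); last by move=> x; exact: compactly_supported_translate.
congr iota; apply/funext => t; rewrite /convolution.
rewrite (step_integral mu_haar oW Wfin sC).
- by apply: eq_bigr => x _; rewrite mulrAC (mulrC (f x)).
- move=> r r' Wr; congr (_ * _).
    by rewrite -(fW r _ Wr) mulVKg.
  by rewrite -(gW _ (r'^-1 * t)%g Wr) mulgA mulgK.
- by move=> r; rewrite mulf_eq0 negb_or => /andP[/fC].
Qed.

Hypothesis small : small_open_subgroups G.
Variable H : subgroup G.
Hypothesis H_open : open (H : set G).
Hypothesis H_compact : compact (H : set G).

Lemma bi_invariant_dense (a : A) (e : Cplx R) : 0 < e ->
  exists (V : subgroup G) (f : G -> Cplx R),
    [/\ open (V : set G), cs f, bi_invariant V f & `|a - iota f| < e].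
Proof.
move=> e0; have [r r0 re] := pos_real_complex e0.
have e20 : 0 < e / 2 by rewrite divr_gt0.
have [f cf af] := iota_dense_approx iotaP a e20.
have [K cK HK] := bi_invariant_approximation small H_open H_compact cf.
set m := fine (mu K); have m0 : 0 <= m by rewrite fine_ge0.
have m1 : 0 < m + 1 by rewrite ltr_wpDl.
(* With c = r / 4 / (m + 1), the bound 2 c mu(K) of [iota_bound] is at most r / 2. *)
have r'0 : 0 < r / 4 / (m + 1) by rewrite !divr_gt0.
have [|V [f' [oV cf' f'V ff' fK]]] := HK (real_complex R (r / 4 / (m + 1))).
  by rewrite (ltr_real_complex 0).
exists V, f'; split=> //.
rewrite -(subrKA (iota f)); apply: le_lt_trans (ler_normD _ _) _.
rewrite (splitr e) ltr_leD//.
rewrite -(iotaB iotaP)//.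
have cB : cs (fun t => f t - f' t).
  rewrite (_ : (fun t => _) = fun t => -1 * f' t + f t).
    exact: compactly_supported_linear.
  by apply/funext => t; rewrite mulN1r addrC.
have fK0 t : ~ K t -> f t - f' t = 0 by move=> /fK[-> ->]; rewrite subrr.
apply: le_trans (iota_bound G_hausdorff mu_haar iotaP cB cK ff' fK0) _.
rewrite re -/m.
have -> : real_complex R r / 2 = real_complex R (r / 2).
  by rewrite rmorphM /= fmorphV /= rmorphMn /= rmorph1.
rewrite ler_real_complex.
have -> : 2 * (r / 4 / (m + 1)) * m = r / 2 * (m / (m + 1)) by field; rewrite gt_eqF.
apply: ler_piMr; first by rewrite divr_ge0// ltW.
by rewrite ler_pdivrMr// mul1r lerDl.
Qed.

(** An approximant of a that is fixed by V bounds the displacement of a by twice the approximation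
    error. *)
Lemma lam_near (a : A) (e : Cplx R) : 0 < e ->
  exists2 V : subgroup G, open (V : set G) &
    forall v, subgroup_set V v -> `|lam v a - a| < e.
Proof.
move=> e0; have e20 : 0 < e / 2 by rewrite divr_gt0.
have [V [f [oV cf [fV _] af]]] := bi_invariant_dense a e20.
exists V => // v Vv.
have lb : lam v (iota f) = iota f.
  apply: (@fixed_element_lam V); last exact: subgroupV.
  by exists f.
rewrite -(subrKA (iota f)) -{1}lb; apply: le_lt_trans (ler_normD _ _) _.
rewrite (splitr e) ler_ltD//; last by rewrite distrC.
by apply: le_trans (lam_lipschitz _ _ _) _; rewrite mul1r ltW.
Qed.

Lemma lam_continuous (a : A) : continuous (fun s => lam s a).
Proof.
move=> s; apply/(@cvgrPdist_lt _ _ _ _ (nbhs_filter s)) => e e0.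
have [V oV Va] := lam_near a e0.
apply: filterS (nbhs_lcoset s oV) => _ [v Vv <-].
rewrite -lamM -lamB; apply: le_lt_trans (lam_le G_hausdorff mu_haar iotaP uP _ _) _.
by rewrite distrC; exact: Va.
Qed.

End TranslationAction.

(** * Subgroups of topological groups *)

Section SubgroupTopologyFacts.
Variables (G : topologicalGroupType) (T : subgroup G).

Lemma nbhs_subgroup (y : T) (U : set T) : nbhs y U ->
  exists2 V : set G, nbhs (subgroup_val y) V & @subgroup_val G T @^-1` V `<=` U.
Proof.
rewrite nbhsE => -[B [[V oV VB] By] BU]; exists V.
  by apply: open_nbhs_nbhs; split=> //; move: By; rewrite -VB.
by rewrite VB.
Qed.

Lemma compact_subgroup_preimage (C : set G) : C `<=` subgroup_set T -> compact C ->
  compact (@subgroup_val G T @^-1` C).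
Proof.
move=> CT cC F FF FC.
have [x [Cx Fx]] := cC (fmap (@subgroup_val G T) F) (fmap_proper_filter _ FF) FC.
exists (subgroup_sub (CT x Cx)); split=> // B U FB /nbhs_subgroup[V Vx VU].
have FvB : fmap (@subgroup_val G T) F (@subgroup_val G T @` B).
  by apply: (@filterS _ F _ B) FB => b Bb; exact: imageP.
have [_ [[b Bb <-] Vb]] := Fx _ _ FvB Vx.
by exists b; split=> //; exact: VU.
Qed.

Lemma restrict_subgroup_open (S : subgroup G) : open (S : set G) ->
  open (restrict_subgroup T S : set T).
Proof. by move=> oS; move/continuousP: (@subgroup_val_continuous G T); exact. Qed.

Lemma small_open_subgroups_subgroup : small_open_subgroups G -> small_open_subgroups T.
Proof.
move=> small U /nbhs_subgroup[V V1 VU]; have [W oW WV] := small V V1.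
exists (restrict_subgroup T W); first exact: restrict_subgroup_open.
by apply: subset_trans VU => t /WV.
Qed.

Lemma hausdorff_subgroup : hausdorff_space G -> hausdorff_space T.
Proof.
move=> hG x y xy; apply: subgroup_val_inj; apply: hG => U V Ux Vy.
have [z [Uz Vz]] := xy _ _ (@subgroup_val_continuous G T x _ Ux)
  (@subgroup_val_continuous G T y _ Vy).
by exists (subgroup_val z).
Qed.

End SubgroupTopologyFacts.

(** * The limit projection *)

Lemma mulrDl1 (K : pzRingType) (x y : K) : (x + 1) * y = x * y + y.
Proof. by rewrite mulrDl mul1r. Qed.

Section SubgroupConstructions.
Variable G : groupType.

Program Definition subgroupI (S T : subgroup G) : subgroup G :=
  @Subgroup G (subgroup_set S `&` subgroup_set T) _ _ _.
Next Obligation. by move=> S T; split; exact: subgroup1. Qed.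
Next Obligation. by move=> S T x y [Sx Tx] [Sy Ty]; split; exact: subgroupM. Qed.
Next Obligation. by move=> S T x [Sx Tx]; split; exact: subgroupV. Qed.

Lemma conjsE (x : G) (S : set G) : conjs x S = (fun t => x^-1 * t * x)%g @^-1` S.
Proof.
apply/seteqP; split=> [_ [t St <-] /=|t /= St].
  by rewrite !mulgA mulVg mul1g mulgVK.
by exists (x^-1 * t * x)%g => //; rewrite !mulgA mulgV mul1g mulgK.
Qed.

End SubgroupConstructions.

Lemma open_conj_subgroup (G : topologicalGroupType) (x : G) (S : subgroup G) :
  open (S : set G) -> open (conj_subgroup x S : set G).
Proof.
move=> oS; rewrite /= conjsE; move: (S : set G) oS; apply/continuousP => t.
exact: (continuous_comp (@continuous_mulgl G x^-1%g t) (@continuous_mulgr G x _)).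
Qed.

Lemma continuous_mul_cplx (R : realType) (T : topologicalType) (f g : T -> Cplx R) :
  continuous f -> continuous g -> continuous (fun x => f x * g x).
Proof. by move=> cf cg x; apply: cvgM; [exact: cf|exact: cg]. Qed.

Section CompletedHeckeAlgebra.
Variables (R : realType) (G : topologicalGroupType).
Variable mu : {measure set (borel G) -> \bar R}.
Variable Delta : G -> R.
Variables (A : cstarAlgebraType R) (iota : (G -> Cplx R) -> A).
Variable u : G -> multiplier A.
Hypothesis G_hausdorff : hausdorff_space G.
Hypothesis small : small_open_subgroups G.
Hypothesis mu_haar : left_haar_measure mu.
Hypothesis iotaP : group_cstar_algebra mu Delta iota.
Hypothesis uP : canonical_multipliers iota u.

(* [G], [H], [S] and [Hinf] stand for B_sigma, H_sigma, the image of B^+ and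
   H_infty; [N] is an open subgroup of the kernel of [tau]. *)
Variables (H N : subgroup G) (tau : G -> Cplx R).
Hypothesis H_open : open (H : set G).
Hypothesis H_compact : compact (H : set G).
Hypothesis mu_H : mu (subgroup_set H) = 1%E.
Hypothesis tau_char : unitary_character H tau.
Hypothesis N_open : open (N : set G).
Hypothesis NH : subgroup_set N `<=` subgroup_set H.
Hypothesis tau_N : forall w, subgroup_set N w -> tau w = 1.

Variable S : set G.
Hypothesis S1 : S 1%g.
Hypothesis SM : forall x y, S x -> S y -> S (x * y)%g.
Hypothesis SH : forall x h, S x -> subgroup_set H h ->
  subgroup_set H (x^-1 * h * x)%g /\ tau (x^-1 * h * x)%g = tau h.
(** Directedness in Ore form: x and y have a common left multiple in S, whose conjugate of H lies
    below both [conjH x] and [conjH y]. *)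
Hypothesis S_directed : forall x y, S x -> S y ->
  exists a b, [/\ S a, S b & (a * x = b * y)%g].
Hypothesis S_dense : forall (g : G) (U : set G), nbhs g U ->
  exists x y, [/\ S x, S y & U (x^-1 * y)%g].

Variable Hinf : subgroup G.

Local Notation cs := (@compactly_supported R G).
Local Notation lam s := (lmul (u s)).
Local Notation lamM := (lamM G_hausdorff mu_haar iotaP uP).
Local Notation lam1 := (lam1 G_hausdorff mu_haar iotaP uP).
Local Notation lam_le := (lam_le G_hausdorff mu_haar iotaP uP).
Local Notation lam_near := (lam_near G_hausdorff mu_haar iotaP uP small H_open H_compact).
Local Notation bi_invariant_dense :=
  (bi_invariant_dense G_hausdorff mu_haar iotaP small H_open H_compact).

(* [conjH x] is x^-1 H x. *)
Definition conjH (x : G) : set G := [set k | subgroup_set H (x * k * x^-1)%g].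

Hypothesis HinfE : forall h, subgroup_set Hinf h <-> forall x, S x -> conjH x h.

(** * The conjugates x^-1 H x and their intersection *)

Lemma conjH_sub x : S x -> conjH x `<=` subgroup_set H.
Proof.
move=> Sx k /(SH Sx)[]; by rewrite !mulgA mulVg mul1g mulgVK.
Qed.

(** Left multiplication by S shrinks the conjugate because a^-1 H a is contained in H. *)
Lemma conjH_mul a x : S a -> conjH (a * x)%g `<=` conjH x.
Proof.
move=> Sa k; rewrite /conjH /= => /(SH Sa)[].
by rewrite invgM !mulgA mulVg mul1g mulgVK.
Qed.

Lemma conjH_closed x : closed (conjH x).
Proof.
have -> : conjH x = subgroup_set (conj_subgroup x^-1 H).
  by rewrite /= conjsE invgK.
exact/open_subgroup_closed/open_conj_subgroup.
Qed.

Lemma conjH_compact x : S x -> compact (conjH x).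
Proof.
move=> Sx; apply: subclosed_compact H_compact (conjH_sub Sx).
exact: conjH_closed.
Qed.

Lemma Hinf_compact : compact (Hinf : set G).
Proof.
have -> : (Hinf : set G) = \bigcap_(x in S) conjH x.
  by apply/seteqP; split=> h /HinfE.
apply: subclosed_compact H_compact _; first by apply: closed_bigI => x _; exact: conjH_closed.
by move=> h /(_ _ S1)/(conjH_sub S1).
Qed.

Lemma conjH_directed (D : seq G) : (forall x, x \in D -> S x) ->
  exists2 z, S z & forall x, x \in D -> conjH z `<=` conjH x.
Proof.
elim: D => [|x D IH] DS; first by exists 1%g.
have [|z Sz zD] := IH; first by move=> y yD; apply: DS; rewrite inE yD orbT.
have [a [b [Sa Sb ab]]] := S_directed (DS x (mem_head _ _)) Sz.
exists (b * z)%g; first exact: SM.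
move=> y; rewrite inE => /predU1P[->|/zD yD].
  by rewrite -ab; exact: conjH_mul.
exact: subset_trans (conjH_mul Sb) yD.
Qed.

(** The complements of the closed sets [conjH x], each enlarged by H_infty W, form an open cover of
    H. If [conjH z] lies in the conjugates of a finite subcover, it misses their complements, so it
    lies in H_infty W. *)
Lemma conjH_near_Hinf (W : subgroup G) : open (W : set G) ->
  exists2 z, S z & forall k, conjH z k ->
    exists2 h, subgroup_set Hinf h & subgroup_set W (h^-1 * k)%g.
Proof.
move=> oW; pose HW : set G := \bigcup_(h in subgroup_set Hinf) lcoset h W.
have := H_compact; rewrite compact_cover.
move=> /(_ G S (fun x => ~` conjH x `|` HW)) [x Sx|k Hk|D DS DH].
- apply: openU; first exact/closed_openC/conjH_closed.
  by apply: bigcup_open => h _; exact: open_lcoset.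
- have [kinf|nk] := pselect (subgroup_set Hinf k).
    exists 1%g => //; right; exists k => //; rewrite lcosetE /= mulVg.
    exact: subgroup1.
  have [x [Sx nxk]] : exists x, S x /\ ~ conjH x k.
    apply: contrapT => nex; apply: nk; apply/HinfE => x Sx.
    by apply: contrapT => nxk; apply: nex; exists x.
  by exists x => //; left.
have [|z Sz zD] := @conjH_directed (enum_fset D).
  by move=> x /DS; rewrite inE.
exists z => // k zk.
have [x xD [nxk|[h hinf]]] := DH k (conjH_sub Sz zk).
  by case: nxk; apply: zD zk.
by rewrite lcosetE; exists h.
Qed.

(** * The projection p_sigma and its conjugates as finite averages *)

Definition hecke_function (t : G) : Cplx R :=
  if t \in subgroup_set H then tau t else 0.

Local Notation pf := hecke_function.
Local Notation p := (iota pf).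

Lemma hecke_function_in t : subgroup_set H t -> pf t = tau t.
Proof. by move=> Ht; rewrite /pf mem_set. Qed.

Lemma hecke_function_notin t : ~ subgroup_set H t -> pf t = 0.
Proof. by move=> Ht; rewrite /pf memNset. Qed.

Lemma hecke_functionMr t h : subgroup_set H h -> pf (t * h)%g = pf t * tau h.
Proof.
move=> Hh; have [Ht|nHt] := pselect (subgroup_set H t).
  rewrite !hecke_function_in//; last exact: subgroupM.
  exact: (characterM tau_char).
rewrite !hecke_function_notin ?mul0r// => Hth; apply: nHt.
by have := subgroupM Hth (subgroupV Hh); rewrite mulgK.
Qed.

Lemma hecke_functionMl t h : subgroup_set H h -> pf (h * t)%g = tau h * pf t.
Proof.
move=> Hh; have [Ht|nHt] := pselect (subgroup_set H t).
  rewrite !hecke_function_in//; last exact: subgroupM.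
  exact: (characterM tau_char).
rewrite !hecke_function_notin ?mulr0// => Hth; apply: nHt.
by have := subgroupM (subgroupV Hh) Hth; rewrite mulKg.
Qed.

Lemma hecke_function_cs : cs pf.
Proof.
split.
  apply: (right_invariant_continuous N_open) => t w Nw.
  by rewrite hecke_functionMr ?tau_N ?mulr1//; exact: NH.
by exists (subgroup_set H) => // x /hecke_function_notin.
Qed.

Lemma tau_lam_hecke h : subgroup_set H h -> tau h *: lam h p = p.
Proof.
move=> Hh; rewrite (uP _ hecke_function_cs).
have := iota_linear iotaP (tau h) (compactly_supported_translate h hecke_function_cs)
  (@compactly_supported0 R G).
rewrite (iota0 iotaP) addr0 => <-; congr iota; apply/funext => t.
by rewrite addr0 -hecke_functionMl// mulVKg.
Qed.

Lemma hecke_fixed : fixed_element iota N p.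
Proof.
exists pf; split=> //; first exact: hecke_function_cs.
by move=> w t Nw; rewrite hecke_functionMl ?tau_N ?mul1r//; exact: NH.
Qed.

(* Multiplication by x^-1 p_sigma x. *)
Definition averaging (x : G) (a : A) : A := lam x^-1%g (cmul p (lam x a)).
Local Notation Q := averaging.

(** Integrating the indicator of H over the cosets of T, and over the single coset H, gives size hs
    * mu(T) = mu(H) = 1. *)
Lemma measure_coset_reps (T : subgroup G) hs : open (T : set G) ->
  subgroup_set T `<=` subgroup_set H -> coset_reps (subgroup_set T) (subgroup_set H) hs ->
  (mu (subgroup_set T) < +oo)%E /\
  real_complex R (fine (mu (subgroup_set T))) = (size hs)%:R^-1.
Proof.
move=> oT TH hsP.
have Tfin : (mu (subgroup_set T) < +oo)%E.
  apply: (@le_lt_trans _ _ (mu (subgroup_set H))); last by rewrite mu_H ltry.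
  by apply: le_measure => //; rewrite inE; exact: borel_open.
split=> //.
pose f t : Cplx R := if t \in subgroup_set H then 1 else 0.
have fT (V : subgroup G) : subgroup_set V `<=` subgroup_set H ->
    forall t t', subgroup_set V (t^-1 * t')%g -> f t = f t'.
  move=> VH t t' /VH Vt; rewrite /f.
  suff -> : (t \in subgroup_set H) = (t' \in subgroup_set H) by [].
  apply/idP/idP => /set_mem Ht; apply/mem_set.
    by have := subgroupM Ht Vt; rewrite mulVKg.
  by have := subgroupM Ht (subgroupV Vt); rewrite invgM invgK mulgA mulgV mul1g.
have fH t : f t != 0 -> subgroup_set H t.
  by rewrite /f; case: ifPn => [/set_mem//|_]; rewrite eqxx.
have e1 := step_integral mu_haar oT Tfin hsP (fT T TH) fH.
have Hfin : (mu (subgroup_set H) < +oo)%E by rewrite mu_H ltry.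
have HP : coset_reps (subgroup_set H) (subgroup_set H) [:: 1%g].
  split=> //.
  - by move=> x; rewrite inE => /eqP ->; exact: subgroup1.
  - by move=> x y; rewrite !inE => /eqP -> /eqP ->.
  - by move=> c Hc; exists 1%g; rewrite ?inE// invg1 mul1g.
have := step_integral mu_haar H_open Hfin HP (fT H (fun _ h => h)) fH.
have f1 : f 1%g = 1 by rewrite /f mem_set//; exact: subgroup1.
rewrite e1 big_seq1 f1 mul1r mu_H /= rmorph1.
rewrite (eq_big_seq (fun=> real_complex R (fine (mu (subgroup_set T))))); last first.
  by move=> h hhs; rewrite /f mem_set ?mul1r//; have [_ + _ _] := hsP; apply.
rewrite big_const_seq count_predT iter_addr_0 => e.
have n0 : (size hs)%:R != 0 :> Cplx R.
  apply/eqP => s0; move: e; rewrite -mulr_natr s0 mulr0 => /eqP.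
  by rewrite eq_sym oner_eq0.
by apply: (mulIf n0); rewrite mulVf// mulr_natr.
Qed.

(** Put T = H n x W x^-1. Then [lam x b] is left T-invariant, and p_sigma is right T-invariant
    because tau is unchanged by conjugation with x and trivial on W. The product is a sum over H/T,
    which conjugation by x^-1 turns into a sum over x^-1 H x modulo W. *)
Lemma averaging_fixed (W : subgroup G) x b ks : S x -> open (W : set G) ->
  subgroup_set W `<=` subgroup_set N -> fixed_element iota W b ->
  coset_reps (subgroup_set W) (conjH x) ks ->
  Q x b = \sum_(k <- ks) ((size ks)%:R^-1 * tau k) *: lam k b.
Proof.
move=> Sx oW WN bW ksP; have [g [cg gW bE]] := bW.
pose T := subgroupI H (conj_subgroup x W).
have oT : open (T : set G) by apply: openI => //; exact: open_conj_subgroup.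
have TH : subgroup_set T `<=` subgroup_set H by move=> t [].
have TW t : subgroup_set T t -> subgroup_set W (x^-1 * t * x)%g.
  by move=> [_ /=]; rewrite conjsE.
have tauT t : subgroup_set T t -> tau t = 1.
  by move=> Tt; rewrite -(SH Sx (TH _ Tt)).2; apply/tau_N/WN/TW.
pose hs := [seq (x * k * x^-1)%g | k <- ks].
have [uks ksC ksW ksE] := ksP.
have hsP : coset_reps (subgroup_set T) (subgroup_set H) hs.
  split.
  - rewrite map_inj_uniq// => k k' /mulIg/mulgI; exact.
  - by move=> _ /mapP[k /ksC ? ->].
  - move=> _ _ /mapP[k kks ->] /mapP[k' k'ks ->] /TW.
    rewrite !invgM !mulgA invgK mulgVK mulVg mul1g mulgVK => /ksW -> //.
  - move=> c Hc; have [|k kks Wk] := ksE (x^-1 * c * x)%g.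
      by rewrite /conjH /= !mulgA mulgV mul1g mulgK.
    exists (x * k * x^-1)%g; first exact: map_f.
    split; first by apply: subgroupM => //; apply: subgroupV; exact: ksC.
    rewrite /= conjsE /= !invgM invgK !mulgA mulVg mul1g.
    by move: Wk; rewrite !mulgA.
have [Tfin muT] := measure_coset_reps oT TH hsP.
have cgx := compactly_supported_translate x cg.
have gxT : left_invariant T (fun t => g (x^-1 * t)%g).
  exact: left_invariant_translate TW gW.
have pfT : right_invariant T pf.
  by move=> t w Tw; rewrite hecke_functionMr ?tauT ?mulr1//; exact: TH.
have pfH t : pf t != 0 -> subgroup_set H t.
  by move=> /eqP nz; apply: contrapT => /hecke_function_notin.
rewrite /Q bE (uP _ cg).
rewrite (convolution_coset_sum mu_haar iotaP uP oT Tfin hecke_function_cs cgx pfT gxT hsP pfH).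
rewrite linear_summation; last exact: lmul_linear.
rewrite big_map; apply: eq_big_seq => k kks.
rewrite (linear_scaling (lmul_linear _)) muT size_map; congr (_ * _ *: _).
  have [Hk tk] := SH Sx (ksC _ kks).
  rewrite hecke_function_in; last exact: ksC.
  by rewrite -tk !mulgA mulVg mul1g mulgVK.
by rewrite -(uP x cg) !lamM !mulgA mulVg mul1g mulgVK.
Qed.

(** * Uniform bounds and convergence of the averages *)

Lemma cmul_lipschitz (c a b : A) : `|cmul c a - cmul c b| <= `|c| * `|a - b|.
Proof.
by rewrite -(linear_subtraction (@cmul_linearr _ _ c)); exact: cnormM.
Qed.

Lemma cmul_lipschitzl (c a b : A) : `|cmul a c - cmul b c| <= `|c| * `|a - b|.
Proof.
rewrite -(linear_subtraction (@cmul_linearl _ _ c)) mulrC; exact: cnormM.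
Qed.

Lemma averaging_linear x : linear (Q x).
Proof.
by move=> c a b; rewrite /Q (lmul_linear (u x)) cmul_linearr lmul_linear.
Qed.

Lemma averaging_le x a : `|Q x a| <= `|p| * `|a|.
Proof.
apply: le_trans (lam_le _ _) _; apply: le_trans (cnormM _ _) _.
by rewrite ler_wpM2l//; exact: lam_le.
Qed.

Lemma averagingM x a b : Q x (cmul a b) = cmul (Q x a) b.
Proof. by rewrite /Q (lmulM (u x)) cmulA lmulM. Qed.

(** S is preordered by reverse inclusion of the conjugates of H rather than by divisibility; limits
    along this filter are limits of the net indexed by B^+. *)
Definition tail : set_system G :=
  filter_from S (fun x => [set y | S y /\ conjH y `<=` conjH x]).

Lemma tail_proper : ProperFilter tail.
Proof.
apply: filter_from_proper; last by move=> x Sx; exists x; split.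
apply: filter_from_filter; first by exists 1%g.
move=> x y Sx Sy; have [|z Sz zD] := @conjH_directed [:: x; y].
  by move=> t; rewrite !inE => /orP[] /eqP ->.
exists z => // t [St tz]; split; split=> //; apply: subset_trans tz _; apply: zD.
  by rewrite !inE eqxx.
by rewrite !inE eqxx orbT.
Qed.
#[local] Existing Instance tail_proper.

(** Once [conjH y] lies in H_infty W, representatives of H_infty modulo W also represent [conjH y]
    modulo W, and the sum in [averaging_fixed] no longer depends on y. *)
Lemma averaging_eventually (W : subgroup G) b ks : open (W : set G) ->
  subgroup_set W `<=` subgroup_set N -> fixed_element iota W b ->
  coset_reps (subgroup_set W) (subgroup_set Hinf) ks ->
  \forall y \near tail, Q y b = \sum_(k <- ks) ((size ks)%:R^-1 * tau k) *: lam k b.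
Proof.
move=> oW WN bW [uks ksC ksW ksE].
have [z Sz zW] := conjH_near_Hinf oW.
exists z => // y [Sy yz]; apply: (averaging_fixed Sy oW WN bW); split=> //.
  by move=> k /ksC/HinfE; exact.
move=> c /yz/zW[h hinf Wh]; have [k kks Wk] := ksE h hinf; exists k => //.
by have := subgroupM Wk Wh; rewrite mulgA mulgK.
Qed.

Lemma subgroup_in_N (V : subgroup G) : open (V : set G) ->
  exists W : subgroup G, [/\ open (W : set G), subgroup_set W `<=` subgroup_set V
    & subgroup_set W `<=` subgroup_set N].
Proof.
move=> oV; exists (subgroupI V N); split; [exact: openI|by move=> t []|by move=> t []].
Qed.

Lemma fixed_element_sub (V W : set G) b : W `<=` V ->
  fixed_element iota V b -> fixed_element iota W b.
Proof.
by move=> WV [f [cf fV bE]]; exists f; split=> // w t /WV; exact: fV.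
Qed.

Lemma bi_invariant_fixed (V : set G) (f : G -> Cplx R) :
  cs f -> bi_invariant V f -> fixed_element iota V (iota f).
Proof. by move=> cf [fV _]; exists f. Qed.

Lemma averaging_eventually_constant (V : subgroup G) b : open (V : set G) ->
  fixed_element iota V b -> exists c, \forall y \near tail, Q y b = c.
Proof.
move=> oV bV; have [W [oW WV WN]] := subgroup_in_N oV.
have [ks ksP] := compact_coset_reps oW Hinf_compact.
eexists; apply: averaging_eventually oW WN _ ksP.
exact: fixed_element_sub bV.
Qed.

Lemma averaging_cvg a : cvg (Q y a @[y --> tail]).
Proof.
apply: cauchy_cvg; apply: cauchy_exP => e e0.
have p1 : 0 < `|p| + 1 by rewrite ltr_wpDl.
have [V [f [oV cf fV af]]] := bi_invariant_dense a (divr_gt0 e0 p1).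
have [c Qc] := averaging_eventually_constant oV (bi_invariant_fixed cf fV).
exists c; apply: filterS Qc => y Qy.
rewrite /ball_ -ball_normE /ball_ /= -Qy -(linear_subtraction (@averaging_linear y)).
apply: le_lt_trans (averaging_le _ _) _; rewrite distrC.
move: af; rewrite ltr_pdivlMr//; apply: le_lt_trans.
by rewrite mulrC ler_wpM2l// lerDl.
Qed.

Definition central_projection (a : A) : A := lim (Q y a @[y --> tail]).
Local Notation P := central_projection.

Lemma central_projectionP a : Q y a @[y --> tail] --> P a.
Proof. exact: averaging_cvg. Qed.

Lemma central_projection_unique a c : Q y a @[y --> tail] --> c -> P a = c.
Proof. by move=> Qc; apply/cvg_lim. Qed.

Lemma central_projection_eventually a c :
  (\forall y \near tail, Q y a = c) -> P a = c.
Proof. by move=> Qc; apply: central_projection_unique; exact: cvg_near_cst. Qed.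

Lemma central_projection_linear : linear P.
Proof.
move=> c a b; apply: central_projection_unique.
under eq_cvg do rewrite averaging_linear.
by apply: cvgD; [apply: cvgZ; [exact: cvg_cst|]|]; exact: central_projectionP.
Qed.

Lemma central_projection_near a e : 0 < e ->
  \forall y \near tail, `|P a - Q y a| < e.
Proof. by have /cvgrPdist_lt := @central_projectionP a; exact. Qed.

Lemma central_projection_le a : `|P a| <= `|p| * `|a|.
Proof.
apply/ler_addgt0Pr => e e0.
have [y Qy] := filter_ex (central_projection_near a e0).
rewrite -(subrK (Q y a) (P a)); apply: le_trans (ler_normD _ _) _.
by rewrite addrC lerD ?averaging_le// ltW.
Qed.

Lemma central_projectionM a b : P (cmul a b) = cmul (P a) b.
Proof.
apply: central_projection_unique; under eq_cvg do rewrite averagingM.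
apply/cvgrPdist_lt => e e0.
have b1 : 0 < `|b| + 1 by rewrite ltr_wpDl.
apply: filterS (central_projection_near a (divr_gt0 e0 b1)) => y.
rewrite ltr_pdivlMr// => Qy; apply: le_lt_trans (cmul_lipschitzl _ _ _) _.
by apply: le_lt_trans Qy; rewrite mulrC ler_wpM2l// lerDl.
Qed.

Lemma central_projection_lipschitz a b : `|P a - P b| <= `|p| * `|a - b|.
Proof.
by rewrite -(linear_subtraction central_projection_linear); exact: central_projection_le.
Qed.

(** * Centrality of the limit *)

Lemma averaging_lam s x a : Q x (lam s a) = lam s (Q (x * s)%g a).
Proof. by rewrite /Q !lamM invgM !mulgA mulgV mul1g. Qed.

(** Given y, write a y = b s. If [conjH x] lies in [conjH b], then [conjH (x * s)] lies in
    [conjH (b * s)] = [conjH (a * y)], hence in [conjH y]. *)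
Lemma tail_mulr s : S s -> (x * s)%g @[x --> tail] --> tail.
Proof.
move=> Ss U [y Sy yU]; have [a [b [Sa Sb ab]]] := S_directed Sy Ss.
exists b => // x [Sx xb] /=; apply: yU; split; first exact: SM.
have xbs : conjH (x * s)%g `<=` conjH (b * s)%g.
  move=> k; rewrite /conjH /= !invgM !mulgA => Hk.
  by have := xb (s * k * s^-1)%g; rewrite /conjH /= !mulgA; apply.
by apply: subset_trans xbs _; rewrite -ab; exact: conjH_mul.
Qed.

Lemma central_projection_lamS s a : S s -> P (lam s a) = lam s (P a).
Proof.
move=> Ss; apply: central_projection_unique.
under eq_cvg do rewrite averaging_lam.
apply: (@cvg_comp _ _ _ (fun x => Q (x * s)%g a) (lmul (u s)) tail (nbhs (P a))).
  apply: (cvg_comp (fun x => x * s)%g (fun y => Q y a)); first exact: tail_mulr.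
  exact: central_projectionP.
exact: lmul_continuous.
Qed.

(** Commutation with s^-1 follows from that with s in S. Any g is then perturbed to some g w = x^-1
    y with x, y in S, where w is so small that it barely moves both a and P a. *)
Lemma central_projection_lam g a : P (lam g a) = lam g (P a).
Proof.
have SV s b : S s -> P (lam s^-1%g b) = lam s^-1%g (P b).
  move=> Ss; have := central_projection_lamS (lam s^-1%g b) Ss.
  by rewrite lamM mulgV lam1 => ->; rewrite lamM mulVg lam1.
apply/eqP; rewrite -subr_eq0 -normr_le0; apply/ler_addgt0Pr => e e0; rewrite add0r.
have p1 : 0 < `|p| + 1 by rewrite ltr_wpDl.
have e20 : 0 < e / (`|p| + 1) by rewrite divr_gt0.
have [V oV Va] := lam_near a e20; have [V' oV' V'a] := lam_near (P a) e20.
have [W oW WV] := small (filterI (nbhs_open_subgroup oV) (nbhs_open_subgroup oV')).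
have [x [y [Sx Sy]]] := S_dense (nbhs_lcoset g oW).
rewrite lcosetE /= => /WV[Vw V'w].
set w := (g^-1 * (x^-1 * y))%g in Vw V'w.
have gw : (g * w)%g = (x^-1 * y)%g by rewrite mulVKg.
have Pgw : P (lam (g * w)%g a) = lam (g * w)%g (P a).
  by rewrite gw -!lamM SV// central_projection_lamS.
have e1 : P (lam g a) - P (lam (g * w)%g a) = P (lam g (a - lam w a)).
  by rewrite (lamB u) (linear_subtraction central_projection_linear) lamM.
have e2 : P (lam (g * w)%g a) - lam g (P a) = lam g (lam w (P a) - P a).
  by rewrite (lamB u) Pgw lamM.
rewrite -(subrKA (P (lam (g * w)%g a))) e1 e2.
apply: le_trans (ler_normD _ _) _.
apply: (@le_trans _ _ (`|p| * (e / (`|p| + 1)) + e / (`|p| + 1))).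
  apply: lerD; last by apply: le_trans (lam_le _ _) _; apply/ltW; exact: V'a.
  apply: le_trans (central_projection_le _) _; rewrite ler_wpM2l//.
  by apply: le_trans (lam_le _ _) _; rewrite distrC; apply/ltW; exact: Va.
by rewrite -mulrDl1 mulrC divfK ?gt_eqF.
Qed.

Lemma fixed_element_sum (I : Type) (r : seq I) (c : I -> Cplx R) (b : I -> A) :
  (forall i, exists2 W : subgroup G, open (W : set G) & fixed_element iota W (b i)) ->
  exists2 W : subgroup G, open (W : set G) &
    fixed_element iota W (\sum_(i <- r) c i *: b i).
Proof.
move=> bW; elim: r => [|i r [W oW [f [cf fW fE]]]].
  exists N => //; rewrite big_nil -(iota0 iotaP); exists (fun=> 0).
  by split=> //; exact: compactly_supported0.
have [V oV [g [cg gV gE]]] := bW i.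
exists (subgroupI V W); first exact: openI.
exists (fun t => c i * g t + f t); split.
- exact: compactly_supported_linear.
- by move=> w t [Vw Ww]; rewrite gV// fW.
- by rewrite big_cons fE gE -(iota_linear iotaP).
Qed.

(** P b is a finite combination of translates [lam k b], the k-th one invariant under k W k^-1;
    finitely many open subgroups intersect in an open one. *)
Lemma fixed_central_projection (V : subgroup G) b : open (V : set G) ->
  fixed_element iota V b ->
  exists2 W : subgroup G, open (W : set G) & fixed_element iota W (P b).
Proof.
move=> oV bV; have [W [oW WV WN]] := subgroup_in_N oV.
have bW := fixed_element_sub WV bV.
have [ks ksP] := compact_coset_reps oW Hinf_compact.
rewrite (central_projection_eventually (averaging_eventually oW WN bW ksP)).
apply: fixed_element_sum => k; exists (conj_subgroup k W).
  exact: open_conj_subgroup.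
by apply: fixed_element_translate bW => // w; rewrite /= conjsE.
Qed.

Definition invariant_image (d : A) := exists (V : subgroup G) (f : G -> Cplx R),
  [/\ open (V : set G), cs f, bi_invariant V f & d = iota f].

Lemma invariant_image_dense a e : 0 < e ->
  exists2 d, invariant_image d & `|a - d| < e.
Proof.
move=> /(bi_invariant_dense a)[V [f [oV cf fV af]]].
by exists (iota f) => //; exists V, f.
Qed.

(** By density, first in a and then in b, both may be taken bi-invariant. The products f g and f
    P(g) are then the same combination of translates of g and of P g, and P commutes with
    translations. *)
Lemma central_projection_central a b : P (cmul a b) = cmul a (P b).
Proof.
apply: (dense_equality (k1 := `|p| * `|b|) (k2 := `|P b|)
  (F1 := fun a => P (cmul a b)) (F2 := fun a => cmul a (P b)) invariant_image_dense).
- by rewrite mulr_ge0.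
- by [].
- move=> x y; apply: le_trans (central_projection_lipschitz _ _) _.
  by rewrite -mulrA ler_wpM2l//; exact: cmul_lipschitzl.
- by move=> x y; exact: cmul_lipschitzl.
move=> {a} _ [V [f [oV cf [_ fV] ->]]].
apply: (dense_equality (k1 := `|p| * `|iota f|) (k2 := `|iota f| * `|p|)
  (F1 := fun b => P (cmul (iota f) b)) (F2 := fun b => cmul (iota f) (P b)) invariant_image_dense).
- by rewrite mulr_ge0.
- by rewrite mulr_ge0.
- move=> x y; apply: le_trans (central_projection_lipschitz _ _) _.
  by rewrite -mulrA ler_wpM2l//; exact: cmul_lipschitz.
- move=> x y; apply: le_trans (cmul_lipschitz _ _ _) _.
  by rewrite -mulrA ler_wpM2l//; exact: central_projection_lipschitz.
move=> {b} _ [V' [g [oV' cg gV' ->]]].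
have [V'' oV'' PV''] := fixed_central_projection oV' (bi_invariant_fixed cg gV').
(* A single W has to serve f on the right, and g and P g on the left. *)
have oVV : open (subgroupI V (subgroupI V' V'') : set G) by do 2 apply: openI => //.
have [W [oW WVV WN]] := subgroup_in_N oVV.
have WV w : subgroup_set W w -> subgroup_set V w by move=> /WVV[].
have WV' w : subgroup_set W w -> subgroup_set V' w by move=> /WVV[_ []].
have WV'' w : subgroup_set W w -> subgroup_set V'' w by move=> /WVV[_ []].
have [h [ch hW hE]] := fixed_element_sub WV'' PV''.
have [_ [K cK fK]] := cf.
have [s sP] := compact_coset_reps oW cK.
have Wfin : (mu (subgroup_set W) < +oo)%E.
  apply: (@le_lt_trans _ _ (mu (subgroup_set H))); last by rewrite mu_H ltry.
  apply: le_measure; rewrite ?inE; [exact: borel_open..|].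
  by move=> w /WN/NH.
have fW : right_invariant W f by move=> t w /WV; exact: fV.
have gW : left_invariant W g by move=> w t /WV'; exact: gV'.1.
have fK' t : f t != 0 -> K t.
  by move=> /eqP ft; apply: contrapT => /fK.
rewrite hE (convolution_coset_sum mu_haar iotaP uP oW Wfin cf cg fW gW sP fK').
rewrite (convolution_coset_sum mu_haar iotaP uP oW Wfin cf ch fW hW sP fK').
rewrite (linear_summation central_projection_linear); apply: eq_bigr => x _.
by rewrite (linear_scaling central_projection_linear) central_projection_lam hE.
Qed.

(** * The ideal generated by p_sigma *)

Lemma averaging_hecke x : S x -> Q x p = p.
Proof.
move=> Sx; have [ks ksP] := compact_coset_reps N_open (conjH_compact Sx).
rewrite (averaging_fixed Sx N_open (fun _ h => h) hecke_fixed ksP).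
have [_ ksC _ ksE] := ksP.
(* As x^-1 H x lies in H, each tau(k) k fixes p, so the average consists of equal terms. *)
rewrite (eq_big_seq (fun=> (size ks)%:R^-1 *: p)); last first.
  move=> k /ksC/(conjH_sub Sx) Hk.
  by rewrite -scalerA tau_lam_hecke.
rewrite big_const_seq count_predT iter_addr_0 -scaler_nat scalerA divff ?scale1r//.
(* The list of representatives is not empty, since the unit lies in [conjH x]. *)
rewrite pnatr_eq0 size_eq0; apply/eqP => ks0.
have [|k] := ksE 1%g; last by rewrite ks0.
by rewrite /conjH /= mulg1 mulgV; exact: subgroup1.
Qed.

Lemma hecke_idempotent : cmul p p = p.
Proof. by have := averaging_hecke S1; rewrite /Q invg1 !lam1. Qed.

Lemma central_projection_hecke : P p = p.
Proof.
by apply: central_projection_eventually; exists 1%g => // y [Sy _]; exact: averaging_hecke.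
Qed.

Lemma central_projection_averaging x a : P (Q x a) = Q x a.
Proof.
by rewrite /Q central_projection_lam central_projectionM central_projection_hecke.
Qed.

Lemma central_projectionK a : P (P a) = P a.
Proof.
apply/eqP; rewrite -subr_eq0 -normr_le0; apply/ler_addgt0Pr => e e0; rewrite add0r.
have p1 : 0 < `|p| + 1 by rewrite ltr_wpDl.
have [y Qy] := filter_ex (central_projection_near a (divr_gt0 e0 p1)).
rewrite -(subrKA (Q y a)) -{1}central_projection_averaging.
apply: le_trans (ler_normD _ _) _; rewrite [X in _ + X]distrC.
apply: le_trans (lerD (central_projection_lipschitz _ _) (lexx _)) _.
by rewrite -mulrDl1 mulrC -ler_pdivlMr// ltW.
Qed.

Lemma central_projection_continuous : continuous P.
Proof.
move=> a; apply/cvgrPdist_lt => e e0.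
have p1 : 0 < `|p| + 1 by rewrite ltr_wpDl.
have ep : 0 < e / (`|p| + 1) by rewrite divr_gt0.
apply: filterS (nbhsx_ballx a _ ep) => b; rewrite -ball_normE /ball_ /=.
rewrite ltr_pdivlMr// => ab; apply: le_lt_trans (central_projection_lipschitz _ _) _.
by apply: le_lt_trans ab; rewrite mulrC ler_wpM2l// lerDl.
Qed.

(** Centrality lets P act on both sides. The definition is transparent so that [lmul] and [rmul] of
    it compute to P. *)
Definition projection_multiplier : multiplier A.
Proof.
apply: (@Multiplier R A P P); try exact: central_projection_linear;
  try exact: central_projection_continuous.
- exact: central_projectionM.
- exact: central_projection_central.
- by move=> a b; rewrite -central_projectionM central_projection_central.
Defined.

(** Since P is idempotent, its range is its set of fixed points, for which closedness and the ideal
    laws are checked directly. *)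
Lemma closed_ideal_generated_hecke :
  closed_ideal_generated p = [set rmul projection_multiplier a | a in [set: A]].
Proof.
have rangeP a : [set P a | a in [set: A]] a <-> P a = a.
  by split=> [[b _ <-]|Pa]; [exact: central_projectionK|exists a].
apply/seteqP; split=> [a|_ [a _ <-] I [Iid Ip]].
- apply; split; last by move=> _ ->; apply/rangeP; exact: central_projection_hecke.
  split.
  + move=> b bcl; apply/rangeP/eqP; rewrite -subr_eq0 -normr_le0.
    apply/ler_addgt0Pr => e e0; rewrite add0r.
    have p1 : 0 < `|p| + 1 by rewrite ltr_wpDl.
    have [c [/rangeP Pc]] := bcl _ (nbhsx_ballx b _ (divr_gt0 e0 p1)).
    rewrite -ball_normE /ball_ /= => bc.
    rewrite -(subrKA c) -{1}Pc; apply: le_trans (ler_normD _ _) _.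
    rewrite [X in _ + X]distrC.
    apply: le_trans (lerD (central_projection_lipschitz _ _) (lexx _)) _.
    by rewrite -mulrDl1 mulrC -ler_pdivlMr// ltW.
  + apply/rangeP; exact: linear_zero central_projection_linear.
  + move=> b c /rangeP Pb /rangeP Pc; apply/rangeP.
    by rewrite (linear_addition central_projection_linear) Pb Pc.
  + move=> k b /rangeP Pb; apply/rangeP.
    by rewrite (linear_scaling central_projection_linear) Pb.
  + by move=> b c /rangeP Pc; apply/rangeP; rewrite central_projection_central Pc.
  + by move=> b c /rangeP Pb; apply/rangeP; rewrite central_projectionM Pb.
- have {}Ip : I p by exact: Ip.
  have IQ y : I (Q y a).
    (* An ideal is not assumed stable under multipliers: writing p = p p lets the translation be
       absorbed in the left factor, an element of A. *)
    rewrite /Q -hecke_idempotent -cmulA lmulM.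
    by apply: (Defs.idealMl Iid); exact: (Defs.idealMr Iid).
  apply: (ideal_closed Iid) => U /central_projectionP PU.
  have [y Uy] := @filter_ex _ tail _ (fun y => U (Q y a)) PU.
  by exists (Q y a).
Qed.

(** * The limit as an integral over H_infty *)

Variable mu_inf : {measure set (borel Hinf) -> \bar R}.
Hypothesis mu_inf_haar : left_haar_measure mu_inf.
Hypothesis mu_inf_T : mu_inf setT = 1%E.

Lemma Hinf_sub h : subgroup_set Hinf h -> subgroup_set H h.
Proof. by move=> /HinfE/(_ _ S1)/(conjH_sub S1). Qed.

Lemma mu_inf_fin (E : set (borel Hinf)) : measurable E -> (mu_inf E < +oo)%E.
Proof.
move=> mE; apply: (@le_lt_trans _ _ (mu_inf setT)); last by rewrite mu_inf_T ltry.
by apply: le_measure; rewrite ?inE.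
Qed.

Lemma mu_inf_coset_reps (V : subgroup Hinf) ks : open (V : set Hinf) ->
  coset_reps (subgroup_set V) setT ks ->
  real_complex R (fine (mu_inf (subgroup_set V))) = (size ks)%:R^-1.
Proof.
move=> oV ksP.
have Vfin : (mu_inf (subgroup_set V) < +oo)%E by apply: mu_inf_fin; exact: borel_open.
have := step_integral (f := fun=> 1) mu_inf_haar oV Vfin ksP (fun _ _ _ => erefl) (fun _ _ => I).
rewrite /complex_integral !Rintegral_cst// mu_inf_T mul0r mulr1.
under eq_bigr do rewrite mul1r.
rewrite big_const_seq count_predT iter_addr_0 => /esym e.
have n0 : (size ks)%:R != 0 :> Cplx R.
  apply/eqP => s0; move: e; rewrite -mulr_natr s0 mulr0 => /eqP.
  by rewrite eq_complex /= eq_sym oner_eq0.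
by apply: (mulIf n0); rewrite mulVf// mulr_natr.
Qed.

Local Notation val := (@subgroup_val G Hinf).
Variable phi : A -> (Cplx R)^o.
Hypothesis phi_linear : scalar phi.
Hypothesis phi_continuous : continuous phi.

Local Notation coef a := (fun h : Hinf => tau (val h) * phi (lam (val h) a)).

(** Both sides average tau(k) phi(lam k b) over H_infty modulo W: the left one because the averages
    stabilise, the right one because the integrand is constant on cosets, tau being trivial on W and
    b fixed by it. *)
Lemma integral_fixed (W : subgroup G) b : open (W : set G) ->
  subgroup_set W `<=` subgroup_set N -> fixed_element iota W b ->
  phi (P b) = complex_integral mu_inf (coef b).
Proof.
move=> oW WN bW; pose V := restrict_subgroup Hinf W.
have oV : open (V : set Hinf) by exact: restrict_subgroup_open.
have cT : compact [set: Hinf].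
  have -> : [set: Hinf] = val @^-1` (Hinf : set G).
    by apply/seteqP; split=> // x _; exact: subgroup_valP.
  by apply: compact_subgroup_preimage => //; exact: Hinf_compact.
have [ks ksP] := compact_coset_reps oV cT.
have [uks _ ksW ksE] := ksP.
have valP : coset_reps (subgroup_set W) (subgroup_set Hinf) (map val ks).
  split.
  - by rewrite map_inj_uniq//; exact: subgroup_val_inj.
  - by move=> _ /mapP[k _ ->]; exact: subgroup_valP.
  - by move=> _ _ /mapP[k kks ->] /mapP[k' k'ks ->] Wk; rewrite (ksW k k').
  - move=> c Hc; have [k kks Wk] := ksE (subgroup_sub Hc) I.
    by exists (val k) => //; exact: map_f.
rewrite (central_projection_eventually (averaging_eventually oW WN bW valP)).
have Vfin : (mu_inf (subgroup_set V) < +oo)%E by apply: mu_inf_fin; exact: borel_open.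
rewrite (step_integral mu_inf_haar oV Vfin ksP) //.
- rewrite (linear_summation phi_linear) big_map; apply: eq_bigr => k _.
  rewrite (linear_scaling phi_linear) (mu_inf_coset_reps oV ksP) size_map.
  by rewrite -[LHS]mulrA mulrC.
- move=> t t' Vt.
  have Wt : subgroup_set W ((val t)^-1 * val t')%g by [].
  rewrite -[t' in RHS](mulVKg t) subgroup_valM subgroup_valM subgroup_valV.
  rewrite (characterM tau_char); [|exact/Hinf_sub/subgroup_valP|exact/NH/WN].
  by rewrite (tau_N (WN _ Wt)) mulr1 -lamM (fixed_element_lam uP bW (subgroupV Wt)).
Qed.

Lemma projection_integral a : phi (P a) = complex_integral mu_inf (coef a).
Proof.
have [k k0 phik] := linear_continuous_bounded phi_linear phi_continuous.
have [kr kr0 kE] := pos_real_complex k0.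
have bound b h : `|coef b h| <= k * `|b|.
  rewrite normrM (character_norm tau_char) ?mul1r; last exact/Hinf_sub/subgroup_valP.
  by apply: le_trans (phik _) _; apply: ler_wpM2l; [exact: ltW|exact: lam_le].
have cont b : continuous (coef b).
  have ct : continuous (fun h : Hinf => tau (val h)).
    apply: (right_invariant_continuous (V := restrict_subgroup Hinf N)).
      exact: restrict_subgroup_open.
    move=> t w Nw; rewrite subgroup_valM (characterM tau_char) ?(tau_N Nw) ?mulr1//.
      exact/Hinf_sub/subgroup_valP.
    exact: NH.
  have cl : continuous (fun h : Hinf => phi (lam (val h) b) : Cplx R).
    have lc : continuous (fun s => lam s b).
      exact: (lam_continuous G_hausdorff mu_haar iotaP uP small H_open H_compact).
    move=> h; have cl' := continuous_comp (@subgroup_val_continuous G Hinf h) (lc (val h)).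
    apply/(@cvgrPdist_lt _ _ _ _ (nbhs_filter h)) => e e0.
    have /cvgrPdist_lt/(_ _ (divr_gt0 e0 k0)) := cl'.
    apply: filterS => h' /=; rewrite ltr_pdivlMr// mulrC; apply: le_lt_trans.
    by apply: le_trans (phik _); rewrite (linear_subtraction phi_linear).
  exact: continuous_mul_cplx ct cl.
have int b (c : R) : k * `|b| <= real_complex R c -> cintegrable mu_inf (coef b) /\
    `|complex_integral mu_inf (coef b)| <= real_complex R (2 * c * fine (mu_inf setT)).
  move=> bc; apply: complex_integral_bound => //.
  - by rewrite mu_inf_T ltry.
  - by move=> t; apply: le_trans (bound b t) bc.
  - by move=> t /(_ I).
have norm_real : forall d : A, exists c : R, `|d| = real_complex R c.
  by move=> d; have [r0 _ rE] := ge0_real_complex (normr_ge0 d); exists r0.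
have intb b : cintegrable mu_inf (coef b).
  have [c cE] := norm_real b.
  by have [] := int b (kr * c); first rewrite kE cE rmorphM.
have inte b (c : Cplx R) : `|b| <= c -> `|complex_integral mu_inf (coef b)| <= 2 * (k * c).
  move=> bc; have [r r0 rE] := ge0_real_complex (le_trans (normr_ge0 _) bc).
  have [|_] := int b (kr * r).
    by rewrite rmorphM /= -kE -rE; apply: ler_wpM2l => //; exact: ltW.
  move=> /le_trans; apply; rewrite mu_inf_T mulr1 !rmorphM /= -kE -rE.
  by rewrite rmorphMn rmorph1.
apply/eqP; rewrite -subr_eq0 -normr_le0; apply/ler_addgt0Pr => e e0; rewrite add0r.
(* As functions of a, the two sides have Lipschitz constants k |p| and 2 k, where k bounds phi,
   H_infty has mass 1 and 2 is the factor of [complex_integral_bound]. *)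
have kp : 0 < k * `|p| + 2 * k by apply: ltr_wpDl; rewrite ?mulr_gt0 ?mulr_ge0// ltW.
have [b [V [f [oV cf fV bE]]] ab] := invariant_image_dense a (divr_gt0 e0 kp).
have [W [oW WV WN]] := subgroup_in_N oV.
have bW : fixed_element iota W b.
  by rewrite bE; apply: fixed_element_sub WV _; exact: bi_invariant_fixed.
rewrite -(subrKA (phi (P b))) {2}(integral_fixed oW WN bW).
apply: le_trans (ler_normD _ _) _.
rewrite -(linear_subtraction phi_linear) -(linear_subtraction central_projection_linear).
rewrite -complex_integralB//.
have -> : (fun t => coef b t - coef a t) = coef (b - a).
  apply/funext => h /=.
  by rewrite (lamB u) (linear_subtraction phi_linear) mulrBr.
have ba : `|b - a| <= e / (k * `|p| + 2 * k) by rewrite distrC ltW.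
apply: (@le_trans _ _ (k * (`|p| * (e / (k * `|p| + 2 * k))) + 2 * (k * (e / (k * `|p| + 2 * k))))).
  apply: lerD; last exact: inte.
  apply: le_trans (phik _) _; apply: ler_wpM2l; first exact: ltW.
  by apply: le_trans (central_projection_le _) _; apply: ler_wpM2l => //; exact: ltW.
by rewrite (mulrA k) (mulrA 2) -mulrDl mulrC divfK ?gt_eqF.
Qed.

End CompletedHeckeAlgebra.

(** * Hecke completions *)

Section FiniteCovers.
Variable G : groupType.
Implicit Types A : set G.

(** Finite index by means of a list of representatives that need not lie in A; this form passes
    easily to chains, intersections and closures. *)
Definition finitely_covered A (T : set G) :=
  exists s : seq G, forall a, A a -> exists2 x, x \in s & T (x^-1 * a)%g.

Lemma finite_index_covered A (T : subgroup G) :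
  finite_index A T -> finitely_covered A (subgroup_set T).
Proof.
move=> /finite_seqP[s sE]; exists [seq xget 1%g X | X <- s] => a Aa.
have : [set lcoset a0 T | a0 in A] (lcoset a T) by exists a.
rewrite sE /= => aTs; exists (xget 1%g (lcoset a T)); first exact: map_f.
have aTa : lcoset a T a by exists 1%g; [exact: subgroup1|rewrite mulg1].
have [t Tt <-] := xgetI 1%g aTa.
by rewrite invgM mulgVK; exact: subgroupV.
Qed.

Lemma finitely_covered_trans A (T1 T2 : set G) :
  finitely_covered A T1 -> finitely_covered T1 T2 -> finitely_covered A T2.
Proof.
move=> [s sA] [r rT]; exists [seq (x * y)%g | x <- s, y <- r] => a /sA[x xs /rT[y yr T2y]].
exists (x * y)%g; first by apply/allpairsP; exists (x, y).
by rewrite invgM -mulgA.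
Qed.

(** A nonempty intersection of x T1 and y T2 is a single coset of the intersection of T1 and T2, and
    any of its points represents it. *)
Lemma finitely_coveredI A (T1 T2 : subgroup G) :
  finitely_covered A T1 -> finitely_covered A T2 ->
  finitely_covered A (subgroup_set T1 `&` subgroup_set T2).
Proof.
move=> [s sA] [r rA].
pose cell x y := [set a : G | subgroup_set T1 (x^-1 * a)%g /\ subgroup_set T2 (y^-1 * a)%g].
exists [seq xget 1%g (cell x y) | x <- s, y <- r] => a Aa.
have [x xs T1x] := sA a Aa; have [y yr T2y] := rA a Aa.
exists (xget 1%g (cell x y)); first by apply/allpairsP; exists (x, y).
have [T1z T2z] := @xgetI _ 1%g (cell x y) a (conj T1x T2y).
set z := xget _ _ in T1z T2z *; split.
  by have := subgroupM (subgroupV T1z) T1x; rewrite invgM invgK mulgA mulgK.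
by have := subgroupM (subgroupV T2z) T2y; rewrite invgM invgK mulgA mulgK.
Qed.

Lemma finitely_covered_sub A (T1 T2 : set G) : T1 `<=` T2 ->
  finitely_covered A T1 -> finitely_covered A T2.
Proof.
by move=> T12 [s sA]; exists s => a /sA[x xs /T12 Tx]; exists x.
Qed.

End FiniteCovers.

Section HeckeCompletion.
Variables (G : groupType) (K : subgroup G) (L : topologicalGroupType).
Variable j : {multiplicative G -> L}.
Hypothesis jP : hecke_completion K j.

Local Notation cl T := (subgroup_set (completed_subgroup j T)).

Lemma multiplicative_group1 : j 1%g = 1%g.
Proof. by apply: (mulgI (j 1%g)); rewrite -gmulfM !mulg1. Qed.

Lemma multiplicative_groupV x : j x^-1%g = (j x)^-1%g.
Proof. by apply: (mulgI (j x)); rewrite -gmulfM !mulgV multiplicative_group1. Qed.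

Lemma subgroup_nbhs_open (S : subgroup L) : nbhs 1%g (S : set L) -> open (S : set L).
Proof.
move=> S1; rewrite openE => x Sx; rewrite /interior.
have : nbhs x ((fun t => x^-1 * t)%g @^-1` subgroup_set S).
  by apply: continuous_mulgl; rewrite mulVg.
by apply: filterS => y /= Sy; have := subgroupM Sx Sy; rewrite mulVKg.
Qed.

Lemma closure_image_near (T : subgroup G) (x : L) (U : set L) :
  cl T x -> nbhs x U -> exists2 t, subgroup_set T t & U (j t).
Proof. by move=> Tx /Tx[_ [[t Tt <-] Ut]]; exists t. Qed.

(** Some open W around the unit satisfies j^-1(W) in T; as the range of j is dense, W lies in the
    closure of j(T). *)
Lemma completed_subgroup_open (T : subgroup G) : hecke_nbhs1 K T ->
  open (completed_subgroup j T : set L).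
Proof.
move=> /(completion_nbhs1 jP)[V V1 VT]; apply: subgroup_nbhs_open.
move: V1; rewrite {1}nbhsE => -[W [oW W1] WV].
have nW z : W z -> nbhs z W by move=> Wz; apply: open_nbhs_nbhs.
apply: (filterS _ (nW _ W1)) => z Wz U Uz.
have : closure (range j) z by rewrite (completion_dense jP).
move=> /(_ _ (filterI Uz (nW _ Wz)))[_ [[g _ <-] [Ug Wg]]].
by exists (j g); split=> //; exists g => //; apply/VT/WV.
Qed.

(** Regularity at the unit: the closure of V1 lies in V1 V2 whenever V2 is a neighbourhood of the
    unit. *)
Lemma nbhs1_closure (U : set L) : nbhs 1%g U ->
  exists2 V, nbhs 1%g V & closure V `<=` U.
Proof.
move=> U1; have := @mulg_continuous L (1%g, 1%g) U.
rewrite /= mulg1 => /(_ U1)[[V1 V2] /= [V11 V21] VU].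
exists V1 => // z zV.
have nV : nbhs 1%g [set v | V2 v^-1%g].
  by have := @invg_continuous L 1%g V2; rewrite invg1; apply.
have nz : nbhs z ((fun t => z^-1 * t)%g @^-1` [set v | V2 v^-1%g]).
  by apply: continuous_mulgl; rewrite mulVg.
have [y [V1y]] := zV _ nz; rewrite /= invgM invgK => V2y.
by have := VU (y, y^-1 * z)%g (conj V1y V2y); rewrite /= mulVKg.
Qed.

(** The basic neighbourhoods of the Hecke topology; their closures form a base of open subgroups at
    the unit of the completion. *)
Definition core_subgroup (F : {fset G}) : subgroup G :=
  bigcap_subgroup [set` F] (fun x => conj_subgroup x K).

Lemma core_subgroup_nbhs F : hecke_nbhs1 K (core_subgroup F).
Proof. by exists F. Qed.

Lemma completion_small_core (U : set L) : nbhs 1%g U ->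
  exists F, cl (core_subgroup F) `<=` U.
Proof.
move=> /nbhs1_closure[V V1 VU].
have [F FV] : hecke_nbhs1 K (j @^-1` V).
  by apply/(completion_nbhs1 jP); exists V.
exists F; apply: subset_trans VU; apply: closureS => _ [t Ft <-].
exact: FV.
Qed.

Lemma completion_small_open : small_open_subgroups L.
Proof.
move=> U /completion_small_core[F FU].
by exists (completed_subgroup j (core_subgroup F)) => //;
  exact/completed_subgroup_open/core_subgroup_nbhs.
Qed.

Variable H : subgroup G.
Hypothesis KK : hecke_pair K.
Hypothesis HK : finitely_covered H K.
Hypothesis KH : subgroup_set K `<=` subgroup_set H.

(** K has finite index in H, and K n x K x^-1 has finite index in K by the Hecke condition, for each
    of the finitely many x in F. *)
Lemma core_subgroup_covered F : finitely_covered H (core_subgroup F).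
Proof.
apply: finitely_covered_trans HK _.
have KxK x : finitely_covered K (conj_subgroup x K).
  apply: (finitely_covered_sub (T1 := subgroupI K (conj_subgroup x K))); first by move=> t [].
  by apply: finite_index_covered; exact: KK.
suff main (s : seq G) : finitely_covered K (bigcap_subgroup [set` s] (fun x => conj_subgroup x K)).
  apply: finitely_covered_sub (main (enum_fset F)) => t tF x xF; exact: tF.
elim: s => [|x s IH].
  exists [:: 1%g] => a _; exists 1%g; first by rewrite inE.
  by move=> x.
apply: finitely_covered_sub (finitely_coveredI (KxK x) IH) => t [xt st] y /=.
by rewrite inE => /predU1P[->|/st].
Qed.

Lemma completed_decomposition (T : subgroup G) (h : L) :
  open (completed_subgroup j T : set L) -> cl H h ->
  exists h0 t, [/\ subgroup_set H h0, cl T t & h = (j h0 * t)%g].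
Proof.
move=> oT Hh; have [h0 Hh0] := closure_image_near Hh (nbhs_lcoset h oT).
rewrite lcosetE => Tt; exists h0, ((j h0)^-1 * h)%g; split=> //.
  by have := subgroupV Tt; rewrite invgM invgK.
by rewrite mulVKg.
Qed.

Lemma completed_cover F : exists s : seq L, forall h, cl H h ->
  exists2 x, x \in s & cl (core_subgroup F) (x^-1 * h)%g.
Proof.
have [s sH] := core_subgroup_covered F; exists (map j s) => h.
move=> Hh; have [h0 [t [Hh0 Tt ->]]] :=
  completed_decomposition (completed_subgroup_open (core_subgroup_nbhs F)) Hh.
have [x xs Tx] := sH _ Hh0; exists (j x); first exact: map_f.
rewrite mulgA; apply: subgroupM => //; apply: subset_closure.
by exists (x^-1 * h0)%g => //; rewrite gmulfM multiplicative_groupV.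
Qed.

Lemma ultra_finite_cover (F : set_system L) (A : set L) (I : eqType) (s : seq I) (B : I -> set L) :
  UltraFilter F -> F A -> (forall a, A a -> exists2 x, x \in s & B x a) ->
  exists2 x, x \in s & F (B x).
Proof.
move=> FU; elim: s A => [|x s IH] A FA AB.
  by have [a /AB[]] := filter_ex FA.
have [FB|FB] := in_ultra_setVsetC (B x) FU; first by exists x => //; rewrite mem_head.
have [|a [Aa nBa]|y ys FBy] := IH (A `&` ~` B x); first exact: filterI.
  by have [z] := AB a Aa; rewrite inE => /predU1P[->//|zs Bz]; exists z.
by exists y => //; rewrite inE ys orbT.
Qed.

(** Completeness and total boundedness: an ultrafilter on H_sigma selects one coset from each finite
    cover, hence is Cauchy. *)
Lemma completed_compact : compact (completed_subgroup j H : set L).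
Proof.
rewrite compact_ultra => F FU FH.
have [x Fx] : exists x : L, F --> x.
  apply: (completion_complete jP) => U /completion_small_core[D DU].
  have [s sH] := completed_cover D.
  set T := cl (core_subgroup D) in DU sH.
  have [x1 _ F1] := ultra_finite_cover FU FH sH.
  (* The Cauchy condition is two-sided; covering the inverses by left cosets controls b a^-1 as well
     as a^-1 b. *)
  have [x2 _ F2] := ultra_finite_cover (B := fun x => [set h | T (x^-1 * h^-1)%g]) FU FH
    (fun h Hh => sH _ (subgroupV Hh)).
  exists ([set h | T (x1^-1 * h)%g] `&` [set h | T (x2^-1 * h^-1)%g]); first exact: filterI.
  move=> a b [T1a T2a] [T1b T2b]; split; apply: DU.
    have := subgroupM (subgroupV (T1a : cl _ _)) T1b.
    by rewrite invgM invgK mulgA mulgK.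
  have := subgroupM (subgroupV (T2b : cl _ _)) T2a.
  by rewrite !invgM !invgK mulgA mulgK.
exists x; split=> //; apply: closed_closure => U Ux.
exact: filter_ex (filterI FH (Fx _ Ux)).
Qed.

End HeckeCompletion.

(** * The completed character *)

Section CharacterExtension.
Variables (R : realType) (G : groupType) (H : subgroup G) (sigma : G -> Cplx R).
Hypothesis sigmaP : unitary_character H sigma.

Lemma character1 : sigma 1%g = 1.
Proof.
have H1 := subgroup1 H; have := characterM sigmaP H1 H1; rewrite mulg1.
have n0 : sigma 1%g != 0 by rewrite -normr_eq0 (character_norm sigmaP H1) oner_eq0.
by rewrite -[X in X = _]mulr1 => /(mulfI n0).
Qed.

Lemma characterV h : subgroup_set H h -> sigma h^-1%g = (sigma h)^-1.
Proof.
move=> Hh; have n0 : sigma h != 0.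
  by rewrite -normr_eq0 (character_norm sigmaP Hh) oner_eq0.
apply: (mulfI n0); rewrite divff// -(characterM sigmaP) ?mulgV ?character1//.
exact: subgroupV.
Qed.

Lemma character_kernel_subgroup :
  exists K : subgroup G, subgroup_set K = character_kernel H sigma.
Proof.
have K1 : character_kernel H sigma 1%g by split; [exact: subgroup1|exact: character1].
have KM x y : character_kernel H sigma x -> character_kernel H sigma y ->
    character_kernel H sigma (x * y)%g.
  move=> [Hx sx] [Hy sy]; split; first exact: subgroupM.
  by rewrite (characterM sigmaP)// sx sy mulr1.
have KV x : character_kernel H sigma x -> character_kernel H sigma x^-1%g.
  by move=> [Hx sx]; split; [exact: subgroupV|rewrite characterV// sx invr1].
by exists (Subgroup K1 KM KV).
Qed.

(** The fibres of sigma are the cosets of its kernel, and there are finitely many. *)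
Lemma character_kernel_covered : finite_set (sigma @` H) ->
  finitely_covered H (character_kernel H sigma).
Proof.
move=> /finite_seqP[s sE].
pose fib v := [set h | subgroup_set H h /\ sigma h = v].
exists [seq xget 1%g (fib v) | v <- s] => h Hh.
have vs : sigma h \in s.
  have : (sigma @` H) (sigma h) by exists h.
  by rewrite sE.
exists (xget 1%g (fib (sigma h))); first exact: map_f.
have [Hz sz] := @xgetI _ 1%g (fib (sigma h)) h (conj Hh erefl).
split; first by apply: subgroupM => //; exact: subgroupV.
rewrite (characterM sigmaP) ?characterV ?sz//; last exact: subgroupV.
by rewrite mulVf// -normr_eq0 (character_norm sigmaP Hh) oner_eq0.
Qed.

(** Values of a character commute, so inner conjugation does not change it. *)
Lemma character_stabiliser_sub : subgroup_set H `<=` character_stabiliser H sigma.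
Proof.
move=> x Hx h [Hh _]; have Hx' := subgroupV Hx.
rewrite (characterM sigmaP)//; last exact: subgroupM.
rewrite (characterM sigmaP)// mulrAC -(characterM sigmaP)// mulVg character1.
by rewrite mul1r.
Qed.

Variables (L : topologicalGroupType) (j : {multiplicative G -> L}).
Variables (tau : L -> Cplx R) (K : subgroup G).
Hypothesis KE : subgroup_set K = character_kernel H sigma.
Hypothesis tauP : character_extension j H sigma tau.

Local Notation cl T := (subgroup_set (completed_subgroup j T)).

Lemma character_kernel_sub : subgroup_set K `<=` subgroup_set H.
Proof. by rewrite KE => x []. Qed.

Lemma completed_subgroup_sub (S T : subgroup G) :
  subgroup_set S `<=` subgroup_set T -> cl S `<=` cl T.
Proof. by move=> ST; apply: closureS => _ [x Sx <-]; exists x => //; exact: ST. Qed.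

Lemma completed_subgroup_image (T : subgroup G) x : subgroup_set T x -> cl T (j x).
Proof. by move=> Tx; apply: subset_closure; exists x. Qed.

(** Arbitrarily close to j(h) k lie points j(h k0) with k0 in K, where tau equals sigma(h). With
    H_sigma = j(H) K_sigma, this reduces all identities for tau to identities for sigma. *)
Lemma character_extensionE h k : subgroup_set H h -> cl K k ->
  tau (j h * k)%g = sigma h.
Proof.
move=> Hh Kk; set x := (j h * k)%g.
have Hx : cl H x.
  apply: subgroupM; first exact: completed_subgroup_image.
  exact: completed_subgroup_sub character_kernel_sub _ Kk.
apply/eqP; rewrite -subr_eq0 -normr_le0; apply/ler_addgt0Pr => e e0; rewrite add0r.
have [ct tauj] := tauP.
have /cvgrPdist_lt/(_ _ e0) : tau @ within (cl H) (nbhs x) --> tau x.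
  by move/subspace_continuousP : ct; exact.
rewrite near_withinE => Ux.
have nk : nbhs k [set k' | [set t | cl H t -> `|tau x - tau t| < e] (j h * k')%g].
  by apply: continuous_mulgl; exact: Ux.
have [k0 Kk0 /=] := closure_image_near Kk nk.
have [H0 s0] : character_kernel H sigma k0 by rewrite -KE.
rewrite -gmulfM tauj; last exact: subgroupM.
rewrite (characterM sigmaP)// s0 mulr1 => lt_e; apply/ltW/lt_e.
by apply: completed_subgroup_image; exact: subgroupM.
Qed.

Hypothesis K_open : open (completed_subgroup j K : set L).

(** Elements of H_sigma are written j(h) k with k in K_sigma; since j(H) normalises K_sigma, the
    K_sigma factors of a product can be collected on the right. *)
Lemma completed_character : unitary_character (cl H) tau.
Proof.
have conjK h k : subgroup_set H h -> cl K k -> cl K ((j h)^-1 * k * j h)%g.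
  move=> Hh Kk U nU.
  have nk : nbhs k [set k' | U ((j h)^-1 * k' * j h)%g].
    have := continuous_comp (@continuous_mulgl L (j h)^-1%g k) (@continuous_mulgr L (j h) _).
    exact.
  have [k0 Kk0 Uk0] := closure_image_near Kk nk.
  exists ((j h)^-1 * j k0 * j h)%g; split=> //.
  exists (h^-1 * k0 * h)%g; last by rewrite !gmulfM multiplicative_groupV.
  move: Kk0; rewrite KE => -[H0 s0]; split.
    by apply: subgroupM => //; apply: subgroupM => //; exact: subgroupV.
  have Hh' := subgroupV Hh.
  rewrite (characterM sigmaP)//; last exact: subgroupM.
  rewrite (characterM sigmaP)// s0 mulr1 -(characterM sigmaP)// mulVg.
  exact: character1.
split=> [x y Hx Hy|x Hx].
  have [h [k [Hh Kk ->]]] := completed_decomposition K_open Hx.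
  have [h' [k' [Hh' Kk' ->]]] := completed_decomposition K_open Hy.
  rewrite !character_extensionE//.
  have -> : (j h * k * (j h' * k') = j (h * h') * ((j h')^-1 * k * j h' * k'))%g.
    by rewrite gmulfM !mulgA mulgK.
  rewrite character_extensionE ?(characterM sigmaP)//; first exact: subgroupM.
  by apply: subgroupM => //; exact: conjK.
have [h [k [Hh Kk ->]]] := completed_decomposition K_open Hx.
by rewrite character_extensionE// (character_norm sigmaP).
Qed.

(** Conjugation by b^-1 maps H into H by expansion and preserves sigma because b is in B, so it maps
    K into K. Both inclusions pass to closures. *)
Lemma expanding_conj (B : set G) b x :
  B = character_stabiliser H sigma -> expanding B H b -> cl H x ->
  cl H ((j b)^-1 * x * j b)%g /\ tau ((j b)^-1 * x * j b)%g = tau x.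
Proof.
move=> BE [Bb Hb] Hx.
have bHb h : subgroup_set H h ->
    subgroup_set H (b^-1 * h * b)%g /\ sigma (b^-1 * h * b)%g = sigma h.
  move=> Hh; have cHh := Hb h Hh; split; first by move: cHh; rewrite conjsE.
  by apply/esym; move: Bb; rewrite BE; apply.
have conj_cl (T : subgroup G) y : (forall t, subgroup_set T t -> subgroup_set T (b^-1 * t * b)%g) ->
    cl T y -> cl T ((j b)^-1 * y * j b)%g.
  move=> bT Ty U nU.
  have ny : nbhs y [set y' | U ((j b)^-1 * y' * j b)%g].
    have := continuous_comp (@continuous_mulgl L (j b)^-1%g y) (@continuous_mulgr L (j b) _).
    exact.
  have [t Tt Ut] := closure_image_near Ty ny.
  exists ((j b)^-1 * j t * j b)%g; split=> //.
  by exists (b^-1 * t * b)%g; [exact: bT|rewrite !gmulfM multiplicative_groupV].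
split; first by apply: conj_cl Hx => h /bHb[].
have [h [k [Hh Kk ->]]] := completed_decomposition K_open Hx.
have -> : ((j b)^-1 * (j h * k) * j b = j (b^-1 * h * b) * ((j b)^-1 * k * j b))%g.
  by rewrite !gmulfM multiplicative_groupV !mulgA mulgK.
have [Hh' sh'] := bHb h Hh.
rewrite !character_extensionE//; apply: conj_cl Kk => t; rewrite KE => -[Ht st].
by have [Hbt sbt] := bHb t Ht; split; rewrite ?sbt.
Qed.

End CharacterExtension.

(** * From the Hecke triple to the data of the limit projection *)

Theorem theorem7p3 (R : realType) (G : groupType) (H : subgroup G)
    (sigma : G -> Cplx R)
    (reduced_triple : reduced_hecke_triple H sigma)
    (B : subgroup G)
    (B_def : subgroup_set B = character_stabiliser H sigma)
    (B_directed : directed_pair B H)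
    (* the Schlichting completion (G_sigma, H_sigma, sigma) *)
    (Gs : topologicalGroupType) (j : {multiplicative G -> Gs})
    (Gs_completion : hecke_completion (character_kernel H sigma) j)
    (sigmas : Gs -> Cplx R)
    (sigmas_extension : character_extension j H sigma sigmas)
    (* Haar measure on B_sigma, giving H_sigma measure 1 *)
    (mu : {measure set (borel (completed_subgroup j B)) -> \bar R})
    (mu_haar : left_haar_measure mu)
    (mu_normalised : mu [set x : completed_subgroup j B |
       (subgroup_set (completed_subgroup j H)) (subgroup_val x)] = 1%E)
    (Delta : completed_subgroup j B -> R)
    (Delta_modular : modular_function mu Delta)
    (* the C*-algebra of B_sigma, and the image of B_sigma in its multipliers *)
    (A : cstarAlgebraType R)
    (iota : (completed_subgroup j B -> Cplx R) -> A)
    (A_group_cstar : group_cstar_algebra mu Delta iota)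
    (u : completed_subgroup j B -> multiplier A)
    (u_canonical : canonical_multipliers iota u)
    (* normalised Haar measure on H_infty *)
    (mu_infty : {measure set (borel (H_infty_in j B H)) -> \bar R})
    (mu_infty_haar : left_haar_measure mu_infty)
    (mu_infty_normalised : mu_infty setT = 1%E) :
  exists p_infty : multiplier A,
    multiplier_integral mu_infty
      (fun h => sigmas (subgroup_val (subgroup_val h)))
      (fun h => u (subgroup_val h)) p_infty /\
    closed_ideal_generated (iota (hecke_projection H sigmas)) =
      [set rmul p_infty a | a in [set: A]].

Proof.
have [[_ sigma_char sigma_fin] [KK _]] := reduced_triple.
have [K KE] := character_kernel_subgroup sigma_char.
rewrite -KE in KK Gs_completion.
have HK : finitely_covered H K by rewrite KE; exact: character_kernel_covered.
have KH := character_kernel_sub KE.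
have K_nbhs : hecke_nbhs1 K K.
  exists [fset 1%g]%fset => x /(_ 1%g); rewrite /= inE eqxx => /(_ isT).
  by rewrite conjsE /= invg1 mul1g mulg1.
have cK_open := completed_subgroup_open Gs_completion K_nbhs.
have cH_open : open (completed_subgroup j H : set Gs).
  apply: subgroup_nbhs_open; apply: filterS (nbhs_open_subgroup cK_open).
  exact: completed_subgroup_sub.
have HB : subgroup_set H `<=` subgroup_set B.
  by rewrite B_def; exact: character_stabiliser_sub.
set M := completed_subgroup j B.
pose HM := restrict_subgroup M (completed_subgroup j H).
pose NM := restrict_subgroup M (completed_subgroup j K).
pose tau (x : M) := sigmas (subgroup_val x).
have tau_char := completed_character sigma_char KE sigmas_extension cK_open.
pose S := [set x : M | exists2 b, expanding B H b & subgroup_val x = j b].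
have Sj b : expanding B H b -> exists2 x : M, S x & subgroup_val x = j b.
  move=> Eb; have [Bb _] := Eb.
  by exists (subgroup_sub (@completed_subgroup_image _ _ j B _ Bb)) => //; exists b.
have E_M x y : expanding B H x -> expanding B H y -> expanding B H (x * y)%g.
  move=> [Bx Hx] [By Hy]; split; first exact: subgroupM.
  move=> h /Hx; rewrite !conjsE /= => /Hy; rewrite conjsE /=.
  by rewrite !invgM !mulgA.
have M_haus : hausdorff_space M.
  exact: hausdorff_subgroup (completion_hausdorff Gs_completion).
have M_small : small_open_subgroups M.
  exact/small_open_subgroups_subgroup/(completion_small_open Gs_completion).
have HM_open : open (HM : set M) by exact: restrict_subgroup_open.
have HM_compact : compact (HM : set M).
  apply: compact_subgroup_preimage; first exact: completed_subgroup_sub.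
  exact: (completed_compact Gs_completion KK HK).
have tauM_char : unitary_character HM tau.
  split=> [x y Hx Hy|x Hx]; first exact: (characterM tau_char).
  exact: (character_norm tau_char).
have NM_open : open (NM : set M) by exact: restrict_subgroup_open.
have NHM : subgroup_set NM `<=` subgroup_set HM by move=> x; exact: completed_subgroup_sub.
have tauN w : subgroup_set NM w -> tau w = 1.
  move=> Nw; rewrite /tau -[subgroup_val w]mul1g -(multiplicative_group1 j).
  rewrite (character_extensionE sigma_char KE sigmas_extension)//; last exact: subgroup1.
  exact: (character1 sigma_char).
have S1 : S 1%g.
  exists 1%g; last by rewrite (multiplicative_group1 j).
  by split; [exact: subgroup1|move=> h Hh; rewrite conjsE /= invg1 mul1g mulg1].
have SM x y : S x -> S y -> S (x * y)%g.
  move=> [a Ea xa] [b Eb yb]; exists (a * b)%g; first exact: E_M.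
  by rewrite subgroup_valM xa yb gmulfM.
have SH x h : S x -> subgroup_set HM h ->
    subgroup_set HM (x^-1 * h * x)%g /\ tau (x^-1 * h * x)%g = tau h.
  move=> [b Eb xb] Hh.
  have := expanding_conj sigma_char KE sigmas_extension cK_open B_def Eb Hh.
  by rewrite -xb.
have S_dir x y : S x -> S y -> exists a b, [/\ S a, S b & (a * x)%g = (b * y)%g].
  move=> [a Ea xa] [b Eb yb].
  (* Directedness writes a b^-1 as c^-1 d with c, d in B^+, that is, c a = d b. *)
  have : subgroup_set B (a * b^-1)%g.
    by apply: subgroupM; [case: Ea|apply: subgroupV; case: Eb].
  rewrite B_directed => -[c [d [Ec Ed cd]]].
  have [c' Sc' c'E] := Sj c Ec; have [d' Sd' d'E] := Sj d Ed.
  exists c', d'; split=> //; apply: subgroup_val_inj.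
  rewrite !subgroup_valM c'E d'E xa yb -!gmulfM; congr (j _).
  by rewrite -[d](mulVKg c) -cd !mulgA mulgVK.
(* The image of B is dense in B_sigma, and directedness writes each element of B as c^-1 d with c, d
   in B^+. *)
have S_dense (g : M) (U : set M) : nbhs g U -> exists x y, [/\ S x, S y & U (x^-1 * y)%g].
  move=> /nbhs_subgroup[V Vg VU].
  have [b Bb Vb] := closure_image_near (subgroup_valP g) Vg.
  move: Bb; rewrite B_directed => -[c [d [Ec Ed bE]]].
  have [c' Sc' c'E] := Sj c Ec; have [d' Sd' d'E] := Sj d Ed.
  exists c', d'; split=> //; apply: VU => /=.
  by rewrite subgroup_valM subgroup_valV c'E d'E -(multiplicative_groupV j) -gmulfM -bE.
have HinfE h : subgroup_set (H_infty_in j B H) h <->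
    forall x, S x -> conjH HM x h.
  split=> [Hh x [b Eb xb]|Hh b Eb].
    have := Hh b Eb; rewrite /= conjsE /= invgK.
    by rewrite /conjH /= -xb.
  have [x Sx xb] := Sj b Eb.
  by have := Hh x Sx; rewrite /= conjsE /= invgK /conjH /= -xb.
have pE : hecke_projection H sigmas = hecke_function HM tau.
  by apply/funext => x; rewrite /hecke_projection /hecke_function.
exists (projection_multiplier M_haus M_small mu_haar A_group_cstar u_canonical
  HM_open HM_compact mu_normalised tauM_char NM_open NHM tauN S1 SM SH S_dir S_dense HinfE).
split.
  move=> a phi phi_lin phi_cont.
  exact: (projection_integral M_haus M_small mu_haar A_group_cstar u_canonical
    HM_open HM_compact mu_normalised tauM_char NM_open NHM tauN S1 SM SH S_dir HinfE
    mu_infty_haar mu_infty_normalised phi_lin phi_cont).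
by rewrite pE; exact: closed_ideal_generated_hecke.
Qed.
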